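(* Consider a Pólya urn initially containing $b\ge1$ black and $r\ge1$ red balls. In each step a ball is drawn uniformly at random from the urn and is replaced together with $c\ge1$ balls of the same colour. Let $B_n$ and $R_n$ be the numbers of black and red balls after $n$ draws, let $\mathcal F_n$ be the $\sigma$-algebra generated by the first $n$ draws, let $Z_n=\frac{B_n}{B_n+R_n}$, and let $Z_\infty$ be the almost sure limit of $Z_n$ (which exists and has the $\mathrm{Beta}(b/c,r/c)$ distribution). Then $$\mathcal L\left\{\sqrt n\,(Z_\infty-Z_n)\,\big|\,\mathcal F_n\right\}$$ converges, as $n\to\infty$, in the almost sure weak sense to the kernel $\omega\mapsto\mathcal N_{0,S^2(\omega)}$, where $S^2(\omega)=Z_\infty(\omega)(1-Z_\infty(\omega))$; that is, for almost every $\omega$ these conditional distributions converge weakly on $\mathbb R$ to the normal distribution with mean $0$ and variance $S^2(\omega)$.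
   Context: $\mathcal L\{X\mid\mathcal G\}$ denotes a (regular) version of the conditional distribution of the real random variable $X$ given the $\sigma$-algebra $\mathcal G$, viewed as a random probability measure on $\mathbb R$. $\mathcal N_{0,s^2}$ denotes the normal distribution with mean $0$ and variance $s^2$. *)

(* Defs.v *)
From HB Require Import structures.
From mathcomp Require Import all_boot all_order all_algebra.
From mathcomp Require Import all_classical all_reals all_analysis.

Set Implicit Arguments.
Unset Strict Implicit.
Unset Printing Implicit Defensive.

Import Order.TTheory GRing.Theory Num.Theory.
Import numFieldNormedType.Exports.

Local Open Scope classical_set_scope.
Local Open Scope ring_scope.

Section laws.
Context {R : realType}.

(* The Beta distribution of the library only has natural parameters, whereas
   b/c and r/c are positive rationals here. *)
Definition beta_weight (a b x : R) : R := x `^ (a - 1) * (1 - x) `^ (b - 1).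

Definition beta_norm (a b : R) : R :=
  \int[lebesgue_measure]_(x in `]0, 1[) beta_weight a b x.

Definition beta_law (a b : R) (U : set R) : \bar R :=
  (\int[lebesgue_measure]_(x in U `&` `]0%R, 1%R[)
     (beta_weight a b x / beta_norm a b)%:E)%E.

(* Normal distribution with mean 0 and variance s2. The argument of the
   library's [normal_prob] is the standard deviation, and at standard deviation
   0 it is the uniform distribution on [0, 1]; variance 0 has to be the Dirac
   mass at 0. *)
Definition centered_normal (s2 : R) :
    probability (measurableTypeR R) R :=
  if 0 < s2 then [the probability _ _ of normal_prob 0 (Num.sqrt s2)]
  else [the probability _ _ of \d_(0 : measurableTypeR R)].

Definition weak_cvg (mu : nat -> {measure set (measurableTypeR R) -> \bar R})
    (nu : {measure set (measurableTypeR R) -> \bar R}) : Prop :=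
  forall f : R -> R, continuous f -> [bounded f x | x in [set: R]] ->
    (\int[mu n]_x (f x)%:E @[n --> \oo] --> \int[nu]_x (f x)%:E)%E.

End laws.

Section conditioning.
Context {d : measure_display} {T : measurableType d} {R : realType}.
Variable P : probability T R.

(* k is a regular version of the conditional distribution of Y given the
   sigma-algebra <<s G >>. *)
Definition regular_cond_distribution (G : set (set T)) (Y : T -> R)
    (k : R.-pker (g_sigma_algebraType G) ~> (measurableTypeR R)) : Prop :=
  forall (A : set T) (U : set (measurableTypeR R)), <<s G >> A -> measurable U ->
    (\int[P]_(w in A) k w U = P (A `&` Y @^-1` U))%E.

Definition as_weak_cvg
    (k : nat -> T -> {measure set (measurableTypeR R) -> \bar R})
    (nu : T -> {measure set (measurableTypeR R) -> \bar R}) : Prop :=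
  {ae P, forall w, weak_cvg (k ^~ w) (nu w)}.

End conditioning.

Section urn.
Context {d : measure_display} {T : measurableType d} {R : realType}.
Variable P : probability T R.
Variables (b r c : nat) (X : nat -> {RV P >-> bool}).

(* X i w = true means that draw i.+1 gives a black ball. *)
Definition black (n : nat) (w : T) : nat := (b + c * \sum_(i < n) X i w)%N.
Definition red (n : nat) (w : T) : nat := (r + c * \sum_(i < n) ~~ X i w)%N.

Definition black_ratio (n : nat) (w : T) : R :=
  (black n w)%:R / (black n w + red n w)%:R.

Definition first_draws (n : nat) : set (set T) :=
  \bigcup_(i in `I_n) preimage_set_system [set: T] (X i) measurable.

(* Given the first n draws, the next ball is uniform among the balls in the urn:
   the conditional probability of black is the current proportion of black. *)
Definition polya_urn : Prop :=
  forall (n : nat) (A : set T), <<s first_draws n >> A ->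
    (P (A `&` [set w | X n w = true]) = \int[P]_(w in A) (black_ratio n w)%:E)%E.

End urn.

(* Main.v *)
Require Import Defs.
From HB Require Import structures.
From mathcomp Require Import all_boot all_order all_algebra.
From mathcomp Require Import all_classical all_reals all_analysis.
From mathcomp Require Import ring lra measurable_realfun.

Set Implicit Arguments.
Unset Strict Implicit.
Unset Printing Implicit Defensive.

Import Order.TTheory GRing.Theory Num.Theory.
Import numFieldNormedType.Exports.

Local Open Scope classical_set_scope.
Local Open Scope ring_scope.

(** The urn restarts after each draw, so everything rests on the law of its limit
   for arbitrary initial contents. Let [a] and [b] be the numbers of black and red
   balls divided by [c]. The urn is a mixture of coin tosses: its transition
   probabilities [a / (a + b)] and [b / (a + b)] are the ratios of Beta integrals
   that arise when the Beta density with parameters [a] and [b] is multiplied by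
   [x] or by [1 - x] ([urn_mean_mixture]). Under [n] coin tosses with success
   probability [x] the proportion of black balls tends to [x], so the law of the
   proportion after [n] draws tends to the Beta law ([urn_mean_cvg]). Applied to
   the urn observed from time [m] on, this identifies the conditional law of the
   limit given the first [m] draws: it is the Beta law whose parameters are the
   masses present at time [m] ([limit_law]).

   That the proportions converge almost surely follows from a maximal inequality
   ([maximal_ineq]) proved by induction on the number of draws; it bounds the
   probability of an oscillation after time [m] by a multiple of [1 / (m + 1)].

   The mean of the conditional Beta law is the current proportion [Z n], and its
   parameters [(s + n) * Z n] and [(s + n) * (1 - Z n)], with [s] the initial
   total mass, grow linearly. The central limit theorem for the conditional laws
   is thus, for each outcome separately, a statement about Beta densities
   ([beta_local_limit]). After rescaling by the square root of [n] around the
   mean, the density divided by its value there converges to [exp (- y ^ 2 / (2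
   z (1 - z)))] by a second order expansion of the logarithm, and concavity of
   the logarithm gives a Gaussian bound. Dominated convergence concludes without
   computing normalising constants ([weak_cvg_density]). The variance is
   positive, since the limit [z] almost surely lies strictly between 0 and 1. *)

(** * Preliminaries *)

Lemma lipschitz_continuous {R : realType} (f : R -> R) L :
  (forall y z, `|f y - f z| <= L * `|y - z|) -> continuous f.
Proof.
move=> fL x; apply/cvgrPdist_le => e e0.
have L10 : 0 < `|L| + 1 by rewrite ltr_wpDl.
near=> y; apply: le_trans (fL _ _) _.
apply: (@le_trans _ _ ((`|L| + 1) * `|x - y|)).
  by rewrite ler_wpM2r// (le_trans (ler_norm L))// lerDl.
rewrite -ler_pdivlMl// mulrC.
near: y; apply: cvgr_dist_le; first exact: cvg_id.
by rewrite divr_gt0.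
Unshelve. all: by end_near. Qed.

Lemma cvg_invn {R : realType} : (n%:R^-1 : R) @[n --> \oo] --> (0 : R).
Proof.
rewrite -(cvg_shiftn 1); have := @cvg_harmonic R.
by apply: cvg_trans; apply: near_eq_cvg; near=> n; rewrite /harmonic /= addn1.
Unshelve. all: by end_near. Qed.

(** * Beta integrals with positive real parameters *)

Section beta_integrals.
Context {R : realType}.
Notation mu := (@lebesgue_measure R).

Lemma beta_weight_ge0 (a b x : R) : 0 <= beta_weight a b x.
Proof. by rewrite /beta_weight mulr_ge0 ?powR_ge0. Qed.

Lemma beta_weight_gt0 (a b x : R) : x \in `]0, 1[ -> 0 < beta_weight a b x.
Proof.
rewrite in_itv/= => /andP[x0 x1].
by rewrite /beta_weight mulr_gt0 ?powR_gt0 ?subr_gt0.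
Qed.

Lemma measurable_beta_weight (a b : R) :
  measurable_fun [set: R] (beta_weight a b).
Proof.
apply: measurable_funM; first exact: measurable_powR.
have h : measurable_fun [set: R] (fun x : R => 1 - x) by exact: measurable_funB.
exact: (measurableT_comp (@measurable_powR R (b - 1)) h).
Qed.

Let powRS (a x : R) : 0 < x -> x `^ (a + 1 - 1) = x * x `^ (a - 1).
Proof.
move=> x0; rewrite -addrA (addrC 1) addrA (@powRD _ x (a - 1) 1); last first.
  by rewrite (gt_eqF x0) implybT.
by rewrite powRr1 1?mulrC// ltW.
Qed.

Lemma beta_weightSl (a b x : R) : x \in `]0, 1[ ->
  beta_weight (a + 1) b x = x * beta_weight a b x.
Proof.
by rewrite in_itv/= => /andP[x0 x1]; rewrite /beta_weight powRS// mulrA.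
Qed.

Lemma beta_weightSr (a b x : R) : x \in `]0, 1[ ->
  beta_weight a (b + 1) x = (1 - x) * beta_weight a b x.
Proof.
rewrite in_itv/= => /andP[x0 x1].
by rewrite /beta_weight powRS ?subr_gt0// mulrCA.
Qed.

Let powR_01 (k x : R) : 0 <= k -> 0 < x -> x < 1 -> 0 <= x `^ k <= 1.
Proof.
move=> k0 x0 x1; rewrite powR_ge0/= -[leRHS](_ : 1 `^ k = 1); last by rewrite powR1.
by apply: ge0_ler_powR => //; rewrite ?nnegrE ?ltW.
Qed.

(** The shift by 3 keeps [e n] below [1 / 2], so that [I n] is an interval of
   positive length. *)
Let e (n : nat) : R := n.+3%:R^-1.

Let e_gt0 n : 0 < e n. Proof. by rewrite invr_gt0. Qed.

Let e_lt n : e n < 1 - e n.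
Proof.
have : e n <= 3^-1 by rewrite lef_pV2 ?posrE// ler_nat.
by move=> h; lra.
Qed.

Let e_lt1 n : e n < 1. Proof. by have := e_lt n; have := e_gt0 n; lra. Qed.

Let I n := `[e n, 1 - e n]%classic.

Let mI n : measurable (I n : set (measurableTypeR R)). Proof. exact: measurable_itv. Qed.

Let sub_I n : I n `<=` `]0, 1[.
Proof.
move=> x; rewrite /I/= !in_itv/= => /andP[h1 h2].
by have := e_gt0 n; have := e_lt n => h3 h4; apply/andP; split; lra.
Qed.

Let cvg_e : e n @[n --> \oo] --> (0 : R).
Proof.
have h := @cvg_harmonic R.
rewrite -(cvg_shiftn 2) in h.
apply: cvg_trans h; apply: near_eq_cvg; near=> n => /=.
by rewrite /harmonic /e addn2.
Unshelve. all: by end_near. Qed.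

Let is_derive_pow (a b x : R) : x \in `]0, 1[ ->
  is_derive x 1 (fun y : R => y `^ a * (1 - y) `^ b)
    (a * beta_weight a (b + 1) x - b * beta_weight (a + 1) b x).
Proof.
move=> /[!in_itv]/= /andP[x0 x1].
have x10 : 0 < 1 - x by rewrite subr_gt0.
have d1 := @is_derive1_powR R a x x0.
have d2 : is_derive x 1 (fun y : R => 1 - y) (-1).
  by have := is_deriveB (is_derive_cst (1 : R) x 1) (is_derive_id x (1 : R)); rewrite sub0r.
have d3 : is_derive x 1 (fun y : R => (1 - y) `^ b)
    (b * (1 - x) `^ (b - 1) * -1).
  by have := @is_derive1_comp R (fun y => powR y b) (fun y => 1 - y) _ _ _ (@is_derive1_powR R b _ x10) d2.
have := is_deriveM d1 d3.
move/is_derive_eq; apply.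
by rewrite /beta_weight !addrK /GRing.scale/=; ring.
Qed.

Let within_beta_weight n (a b : R) : {within I n, continuous (beta_weight a b)}.
Proof.
apply: derivable_within_continuous => x /sub_I /=; rewrite inE => x01.
have [d _] := is_derive_pow (a - 1) (b - 1) x01.
exact: d.
Qed.

Let integrable_I n (a b : R) : mu.-integrable (I n) (EFin \o beta_weight a b).
Proof.
apply: continuous_compact_integrable; first exact: segment_compact.
exact: within_beta_weight.
Qed.

Let J n (a b : R) := \int[mu]_(x in I n) beta_weight a b x.

Let J_split n a b : J n a b = J n (a + 1) b + J n a (b + 1).
Proof.
rewrite /J -RintegralD//; [|exact: integrable_I..].
apply: eq_Rintegral => x; rewrite inE => /sub_I /= x01.
by rewrite beta_weightSl// beta_weightSr//; ring.
Qed.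

(** Boundary terms of the integration by parts on [I n]. *)
Let bd n (a b : R) := (1 - e n) `^ a * (1 - (1 - e n)) `^ b
  - e n `^ a * (1 - e n) `^ b.

Let J_parts n a b : a * J n a (b + 1) - b * J n (a + 1) b = bd n a b.
Proof.
have ie c a' b' : mu.-integrable (I n) (EFin \o (fun x => c * beta_weight a' b' x)).
  by have := integrableZl (mI n) c (integrable_I n a' b'); apply: eq_integrable.
rewrite /J -!RintegralZl//; try exact: integrable_I; try exact: mI.
rewrite -RintegralB//; try exact: ie.
pose F (y : R) := y `^ a * (1 - y) `^ b.
have In01 x : x \in `]e n, (1 - e n)[ -> x \in `]0, 1[.
  move=> xI; have /sub_I := subset_itv_oo_cc xI.
  by [].
have cF (x : R) : x \in `]0, 1[ -> F y @[y --> x] --> F x.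
  move=> /(is_derive_pow a b) [d _].
  exact/differentiable_continuous/derivable1_diffP.
rewrite /Rintegral (@continuous_FTC2 _ _ F)//.
- by move=> x; apply: cvgB; (apply: cvgMr; exact: within_beta_weight).
- split.
  + by move=> x /In01 /(is_derive_pow a b) [].
  + apply: cvg_at_right_filter; apply: cF.
    by rewrite in_itv/= e_gt0 e_lt1.
  + apply: cvg_at_left_filter; apply: cF.
    by rewrite in_itv/= subr_gt0 e_lt1 ltrBlDr ltrDl e_gt0.
- by move=> x /In01 /(is_derive_pow a b) [_ <-]; rewrite derive1E.
Qed.

Let bd_le1 n a b : 0 < a -> 0 < b -> `|bd n a b| <= 1.
Proof.
move=> a0 b0.
have e1 : 0 < 1 - e n by rewrite subr_gt0.
have e2 : 1 - e n < 1 by rewrite ltrBlDr ltrDl.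
have -> : bd n a b = (1 - e n) `^ a * e n `^ b - e n `^ a * (1 - e n) `^ b.
  by rewrite /bd subKr.
have /andP[h1 h2] := powR_01 (ltW a0) e1 e2.
have /andP[h3 h4] := powR_01 (ltW b0) e1 e2.
have /andP[h5 h6] := powR_01 (ltW a0) (e_gt0 n) (e_lt1 n).
have /andP[h7 h8] := powR_01 (ltW b0) (e_gt0 n) (e_lt1 n).
rewrite ler_norml; apply/andP; split; nra.
Qed.

Let J_le1 n a b : 1 <= a -> 1 <= b -> J n a b <= 1.
Proof.
move=> a1 b1.
have a10 : 0 <= a - 1 by rewrite subr_ge0.
have b10 : 0 <= b - 1 by rewrite subr_ge0.
have : J n a b <= \int[mu]_(x in I n) (cst 1 x).
  apply: le_Rintegral; [exact: mI|exact: integrable_I| |].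
  - apply: continuous_compact_integrable; first exact: segment_compact.
    by move=> x; exact: cst_continuous.
  - move=> x /sub_I /=; rewrite in_itv/= => /andP[x0 x1].
    have /andP[h1 h2] := powR_01 a10 x0 x1.
    have x0' : 0 < 1 - x by lra.
    have x1' : 1 - x < 1 by lra.
    have /andP[h3 h4] := powR_01 b10 x0' x1'.
    by rewrite /beta_weight; nra.
move/le_trans; apply.
rewrite Rintegral_cst//.
have h : fine (mu (I n)) <= 1.
  rewrite /I lebesgue_measure_itv/= lte_fin e_lt/=.
  by have := e_gt0 n; lra.
by rewrite mul1r; exact: h.
Qed.

(** With both parameters at least 1 the weight is at most 1. Integration by
   parts bounds the integrals with parameters (a, b + 2) and (a + 2, b) in terms
   of the one at (a + 1, b + 1), and the splitting lemma descends from there to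
   (a, b), although the weight may be unbounded at 0 and at 1. *)
Let J_bounded (a b : R) : 0 < a -> 0 < b ->
  exists M, forall n, J n a b <= M.
Proof.
move=> a0 b0; exists ((a + 2) / b + 1 + (1 + (b + 2) / a)) => n.
have b10 : 0 < b + 1 by rewrite addr_gt0.
have a10 : 0 < a + 1 by rewrite addr_gt0.
have j11 : J n (a + 1) (b + 1) <= 1 by apply: J_le1; rewrite lerDr ltW.
have h1 : J n a (b + 1 + 1) <= (b + 2) / a.
  have := J_parts n a (b + 1); have := bd_le1 n a0 b10.
  rewrite ler_norml => /andP[_ h] e1; rewrite ler_pdivlMr// mulrC.
  have : (b + 1) * J n (a + 1) (b + 1) <= b + 1 by rewrite ler_piMr// ltW.
  lra.
have h2 : J n (a + 1 + 1) b <= (a + 2) / b.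
  have := J_parts n (a + 1) b; have := bd_le1 n a10 b0.
  rewrite ler_norml => /andP[h _] e1; rewrite ler_pdivlMr// mulrC.
  have : (a + 1) * J n (a + 1) (b + 1) <= a + 1 by rewrite ler_piMr// ltW.
  lra.
rewrite J_split (J_split n (a + 1) b) (J_split n a (b + 1)).
exact: lerD (lerD h2 j11) (lerD j11 h1).
Qed.

Let cvg_J_ereal a b : (J n a b)%:E @[n --> \oo] -->
  (\int[mu]_(x in `]0%R, 1%R[) (beta_weight a b x)%:E)%E.
Proof.
have -> : `]0%R, 1%R[%classic = \bigcup_n I n.
  apply/seteqP; split; last by move=> x [n _] /sub_I.
  move=> /= x; rewrite /= in_itv/= => /andP[x0 x1].
  have m0 : 0 < Num.min x (1 - x) by rewrite lt_min x0 subr_gt0.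
  near \oo => n; exists n => //.
  have : e n <= Num.min x (1 - x).
    near: n.
    move/cvgrPdist_le: cvg_e => /(_ _ m0); apply: filterS => k.
    by rewrite sub0r normrN ger0_norm// ltW.
  by rewrite le_min => /andP[h1 h2]; rewrite /I/= in_itv/=; apply/andP; split; lra.
have -> : (fun n => (J n a b)%:E) =
    (fun n => \int[mu]_(x in I n) (beta_weight a b x)%:E)%E.
  apply/funext => n; rewrite /J /Rintegral fineK//.
  exact: (integrable_fin_num (mI n) (integrable_I n a b)).
apply: ge0_nondecreasing_set_cvg_integral.
- move=> m n mn; rewrite subsetEset => x; rewrite /I/= !in_itv/= => /andP[h1 h2].
  have : e n <= e m by rewrite lef_pV2 ?posrE// ler_nat !ltnS.
  by move=> h; apply/andP; split; lra.
- exact: mI.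
- move=> n; apply/measurable_EFinP/measurable_funTS.
  exact: measurable_beta_weight.
- by move=> n x _; rewrite lee_fin beta_weight_ge0.
Unshelve. all: by end_near. Qed.

(** Monotone convergence along the truncated intervals [I n]. *)
Lemma integrable_beta_weight (a b : R) : 0 < a -> 0 < b ->
  mu.-integrable `]0, 1[ (EFin \o beta_weight a b).
Proof.
move=> a0 b0; apply/integrableP; split.
  by apply/measurable_EFinP/measurable_funTS; exact: measurable_beta_weight.
under eq_integral do rewrite /= ger0_norm ?beta_weight_ge0//.
have [M JM] := J_bounded a0 b0.
apply: (@le_lt_trans _ _ M%:E); last exact: ltry.
apply: (cvge_le _ (@cvg_J_ereal a b)).
by apply: nearW => n; rewrite lee_fin.
Qed.

Lemma EFin_beta_norm (a b : R) : 0 < a -> 0 < b ->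
  (beta_norm a b)%:E = (\int[mu]_(x in `]0%R, 1%R[) (beta_weight a b x)%:E)%E.
Proof.
move=> a0 b0; rewrite /beta_norm /Rintegral fineK//.
exact: (integrable_fin_num _ (integrable_beta_weight a0 b0)).
Qed.

Let cvg_J (a b : R) : 0 < a -> 0 < b -> J n a b @[n --> \oo] --> beta_norm a b.
Proof.
move=> a0 b0; apply: (@fine_cvg _ _ _ _ (fun n => (J n a b)%:E)).
by rewrite EFin_beta_norm//; exact: cvg_J_ereal.
Qed.

Lemma beta_norm_split (a b : R) : 0 < a -> 0 < b ->
  beta_norm a b = beta_norm (a + 1) b + beta_norm a (b + 1).
Proof.
move=> a0 b0; apply: (cvg_unique _ (cvg_J a0 b0)) => //.
rewrite (_ : (fun n => J n a b) = fun n => J n (a + 1) b + J n a (b + 1)); last first.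
  by apply/funext => n; rewrite J_split.
by apply: cvgD; apply: cvg_J => //; lra.
Qed.

Let cvg_bd (a b : R) : 0 < a -> 0 < b -> bd n a b @[n --> \oo] --> (0 : R).
Proof.
move=> a0 b0.
have e0 : e n @[n --> \oo] --> (0 : R)^'+.
  move=> A A0.
  have h : \forall n \near \oo, 0 < e n -> A (e n) by exact: cvg_e A0.
  by apply: (filterS _ h) => n; exact.
have ec (c : R) : 0 < c -> e n `^ c @[n --> \oo] --> (0 : R).
  by move=> c0; exact: (cvg_comp _ _ e0 (powR_cvg0 c0)).
apply/cvgr0Pnorm_le => eps eps0.
have eps20 : 0 < eps / 2 by rewrite divr_gt0.
have /cvgr0Pnorm_le /(_ _ eps20) ha := ec _ a0.
have /cvgr0Pnorm_le /(_ _ eps20) hb := ec _ b0.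
near=> n.
have : `|e n `^ a| <= eps / 2 by near: n.
have : `|e n `^ b| <= eps / 2 by near: n.
rewrite !(ger0_norm (powR_ge0 _ _)) => h1 h2.
have e1 : 0 < 1 - e n by rewrite subr_gt0.
have e2 : 1 - e n < 1 by rewrite ltrBlDr ltrDl.
rewrite /bd subKr.
have /andP[h3 h4] := powR_01 (ltW a0) e1 e2.
have /andP[h5 h6] := powR_01 (ltW b0) e1 e2.
have h7 : 0 <= e n `^ a by exact: powR_ge0.
have h8 : 0 <= e n `^ b by exact: powR_ge0.
rewrite ler_norml; apply/andP; split; nra.
Unshelve. all: by end_near. Qed.

(** The functional equation of the Beta function: the boundary terms of the
   integration by parts vanish in the limit. *)
Lemma beta_norm_parts (a b : R) : 0 < a -> 0 < b ->
  a * beta_norm a (b + 1) = b * beta_norm (a + 1) b.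
Proof.
move=> a0 b0; apply/eqP; rewrite -subr_eq0; apply/eqP.
apply: (cvg_unique _ _ (cvg_bd a0 b0)) => //.
rewrite (_ : (fun n => bd n a b) = fun n => a * J n a (b + 1) - b * J n (a + 1) b); last first.
  by apply/funext => n; rewrite J_parts.
by apply: cvgB; (apply: cvgMr; apply: cvg_J => //; lra).
Qed.

Lemma beta_norm_gt0 (a b : R) : 0 < a -> 0 < b -> 0 < beta_norm a b.
Proof.
move=> a0 b0; rewrite lt_neqAle; apply/andP; split; last first.
  by apply: Rintegral_ge0 => x _; exact: beta_weight_ge0.
apply/eqP => B0; have : (\int[mu]_(x in `]0%R, 1%R[) `|(beta_weight a b x)%:E| = 0)%E.
  under eq_integral do rewrite gee0_abs ?lee_fin ?beta_weight_ge0//.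
  by rewrite -EFin_beta_norm// -B0.
move/ae_eq_integral_abs => [//||N [mN N0 sub]].
  apply/measurable_EFinP/measurable_funTS; exact: measurable_beta_weight.
suff : (mu `]0%R, 1%R[%classic <= mu N)%E.
  by rewrite N0 lebesgue_measure_itv/= lte01 sube0 leNgt lte01.
apply: le_measure; rewrite ?inE// => x x01; apply: sub => /= /(_ x01).
have /(beta_weight_gt0 a b) w0 : x \in `]0, 1[ by [].
by move=> [] /eqP; rewrite gt_eqF.
Qed.

End beta_integrals.

(** * Measures with densities *)

Section densities.
Context {R : realType}.
Notation mu := (@lebesgue_measure R).

(** By uniqueness, the density is almost everywhere the Radon-Nikodym
   derivative, and the change of variables for the derivative applies. *)
Lemma integral_density (nu : {measure set (measurableTypeR R) -> \bar R})
    (q : R -> R) (f : R -> \bar R) :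
  (nu setT < +oo)%E ->
  measurable_fun setT q ->
  (forall U : set R, measurable U -> nu U = \int[mu]_(x in U) (q x)%:E)%E ->
  nu.-integrable setT f ->
  (\int[nu]_x f x = \int[mu]_x (f x * (q x)%:E))%E.
Proof.
move=> nufin mq nuq intf.
pose nu' : {finite_measure set (measurableTypeR R) -> \bar R} :=
  mfrestr measurableT nufin.
have nuE A : nu' A = nu A by rewrite /nu'/= /mfrestr/= /mrestr setIT.
have dom : nu' `<< mu.
  apply/null_content_dominatesP => A mA A0; rewrite nuE nuq//.
  by apply: null_set_integral => //; exact/measurable_EFinP/measurable_funTS.
have nunu' : (\int[nu]_x f x = \int[nu']_x f x)%E.
  by apply: eq_measure_integral => A _ _; rewrite /nu'/= /mfrestr/= /mrestr/= setIT.
rewrite nunu'.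
have intf' : nu'.-integrable setT f.
  have /integrableP[mf f_lty] := intf; apply/integrableP; split => //.
  apply: le_lt_trans f_lty; rewrite le_eqVlt; apply/orP; left; apply/eqP.
  by apply: eq_measure_integral => A _ _; rewrite /nu'/= /mfrestr/= /mrestr/= setIT.
rewrite -(Radon_Nikodym_change_of_variables dom)//.
apply: ae_eq_integral => //.
- apply: emeasurable_funM => //; first exact: measurable_int intf.
- apply: emeasurable_funM => //; first exact: measurable_int intf.
  exact/measurable_EFinP.
- apply: ae_eqe_mul2l.
  apply: integral_ae_eq => //.
  + exact: Radon_Nikodym_integrable.
  + exact/measurable_EFinP.
  + by move=> E _ mE; rewrite -Radon_Nikodym_integral// -nuq//; exact: nuE.
Qed.

(** An affine map with slope [s] transports the Lebesgue measure to its
   multiple by [1 / s], as one sees on intervals. *)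
Lemma integral_affine (s p : R) (g : R -> R) (V : set R) : 0 < s ->
  measurable V -> measurable_fun setT g -> (forall x, 0 <= g x) ->
  (\int[mu]_(x in (fun x => s * (x - p))%R @^-1` V) (g x)%:E =
   \int[mu]_(y in V) (s^-1 * g (p + y / s))%R%:E)%E.
Proof.
move=> s0 mV mg g0.
pose phi : measurableTypeR R -> measurableTypeR R := fun x => s * (x - p).
have mphi : measurable_fun setT phi.
  by apply: measurable_funM => //; exact: measurable_funB.
have sV0 : 0 <= s^-1 by rewrite invr_ge0 ltW.
have mg' : measurable_fun setT (fun y : R => g (p + y / s)).
  apply: (measurableT_comp mg); apply: measurable_funD => //.
  by apply: measurable_funM.
transitivity (\int[pushforward mu phi]_(y in V) (g (p + y / s))%:E)%E.
  rewrite ge0_integral_pushforward//.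
  - apply: eq_integral => x _ /=; congr (g _)%:E.
    by rewrite /phi mulrAC mulfV ?gt_eqF// mul1r addrC subrK.
  - by apply/measurable_EFinP/measurable_funTS.
  - by move=> y _; rewrite lee_fin.
transitivity (\int[mscale (NngNum sV0) mu]_(y in V) (g (p + y / s))%:E)%E.
  apply: eq_measure_integral => A mA _.
  transitivity (s^-1%:E * mu A)%E; last by [].
  suff : mu A = (s%:E * pushforward mu phi A)%E.
    move=> ->; rewrite muleA -EFinM mulVf ?gt_eqF// mul1e//.
  pose pm := measure_function_pushforward__canonical__measure_function_Measure mu mphi.
  transitivity (mscale (NngNum (ltW s0)) pm A); last by [].
  apply: lebesgue_measure_unique => // _ [[a b]] _ <-.
  transitivity (s%:E * mu (phi @^-1` `]a, b]%classic))%E; last by [].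
  have -> : phi @^-1` `]a, b]%classic = `](a / s + p), (b / s + p)]%classic.
    apply/seteqP; split => x; rewrite /phi/= !in_itv/=;
     by rewrite -!ltrBrDr -!lerBlDr ltr_pdivrMr// ler_pdivlMr// ![_ * s]mulrC.
  rewrite !lebesgue_measure_itv/= !lte_fin.
  rewrite ltrD2r ltr_pM2r ?invr_gt0//.
  case: ifPn => _; last by rewrite mule0.
  rewrite -!EFinB -EFinM; congr (_%:E).
  by field; rewrite gt_eqF.
rewrite ge0_integral_mscale//=.
- rewrite -ge0_integralZl//.
  + by apply/measurable_EFinP/measurable_funTS.
  + by move=> y _; rewrite lee_fin.
- by apply/measurable_EFinP/measurable_funTS.
- by move=> y _; rewrite lee_fin.
Qed.

(** Extended by 0 outside the unit interval, so that it is a density with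
   respect to the Lebesgue measure on the whole line. *)
Definition beta_density (a b x : R) : R :=
  if x \in `]0, 1[ then beta_weight a b x / beta_norm a b else 0.

Lemma beta_density_ge0 (a b : R) : 0 < a -> 0 < b ->
  forall x, 0 <= beta_density a b x.
Proof.
move=> a0 b0 x; rewrite /beta_density; case: ifPn => // _.
by rewrite divr_ge0 ?beta_weight_ge0// ltW// beta_norm_gt0.
Qed.

Lemma measurable_beta_density (a b : R) : measurable_fun setT (beta_density a b).
Proof.
have -> : beta_density a b =
    (fun x => beta_weight a b x / beta_norm a b) \_ `]0, 1[.
  by apply/funext => x; rewrite patchE mem_setE.
apply/(measurable_restrictT _ _).1 => //; apply: measurable_funTS.
by apply: measurable_funM => //; exact: measurable_beta_weight.
Qed.

Lemma beta_lawE (a b : R) (U : set R) :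
  beta_law a b U = (\int[mu]_(x in U) (beta_density a b x)%:E)%E.
Proof.
rewrite /beta_law integral_mkcondr; apply: eq_integral => x _.
by rewrite patchE mem_setE /beta_density; case: ifPn.
Qed.

Let beta_law0 (a b : R) : beta_law a b set0 = 0%E.
Proof. by rewrite beta_lawE integral_set0. Qed.

Let beta_norm_ge0 (a b : R) : 0 <= beta_norm a b.
Proof. by apply: Rintegral_ge0 => x _; exact: beta_weight_ge0. Qed.

Let beta_law_ge0 (a b : R) U : (0 <= beta_law a b U)%E.
Proof.
by apply: integral_ge0 => x _; rewrite lee_fin divr_ge0 ?beta_weight_ge0 ?beta_norm_ge0.
Qed.

Let beta_law_sigma_additive (a b : R) :
  semi_sigma_additive (beta_law a b : set (measurableTypeR R) -> \bar R).
Proof.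
move=> F mF tF mUF; apply: cvg_toP.
  apply: ereal_nondecreasing_is_cvgn => m n mn.
  by apply: lee_sum_nneg_natr => // k _ _; exact: beta_law_ge0.
rewrite beta_lawE ge0_integral_bigcup//=.
- by apply: congr_lim; apply/funext => n; apply: eq_bigr => i _; rewrite beta_lawE.
- by apply/measurable_EFinP/measurable_funTS; exact: measurable_beta_density.
- move=> x _; rewrite lee_fin /beta_density; case: ifP => // _.
  by rewrite divr_ge0 ?beta_weight_ge0 ?beta_norm_ge0.
Qed.

HB.instance Definition _ (a b : R) := isMeasure.Build _ _ _
  (beta_law a b : set (measurableTypeR R) -> \bar R)
  (beta_law0 a b) (@beta_law_ge0 a b) (@beta_law_sigma_additive a b).

Lemma beta_lawT (a b : R) : 0 < a -> 0 < b -> beta_law a b setT = 1%E.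
Proof.
move=> a0 b0; rewrite /beta_law setTI.
under eq_integral do rewrite EFinM.
rewrite integralZr//; last exact: integrable_beta_weight.
rewrite -EFin_beta_norm// -EFinM mulfV// gt_eqF//.
exact: beta_norm_gt0.
Qed.

(** Dominated convergence for densities known only up to normalisation: the
   constants [C n] need not be computed, because testing against 1 expresses
   them as inverses of integrals that converge as well. *)
Lemma weak_cvg_density (h : nat -> R -> R) (g D : R -> R) (C : nat -> R) (c : R)
    (nu : nat -> {measure set (measurableTypeR R) -> \bar R})
    (nu0 : {measure set (measurableTypeR R) -> \bar R}) :
  (forall n, measurable_fun setT (h n)) -> measurable_fun setT g ->
  (forall n x, `|h n x| <= D x) -> mu.-integrable setT (EFin \o D) ->
  (forall x, h n x @[n --> \oo] --> g x) ->
  (forall n U, measurable U ->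
     nu n U = \int[mu]_(x in U) (C n * h n x)%:E)%E ->
  (forall U, measurable U -> nu0 U = \int[mu]_(x in U) (c * g x)%:E)%E ->
  (forall n, nu n setT = 1%E) -> nu0 setT = 1%E ->
  weak_cvg nu nu0.
Proof.
move=> mh mg hD intD hg nuE nu0E nu1 nu01 f cf bf.
have mf : measurable_fun setT f by exact: continuous_measurable_fun.
have [M M0 fM] : exists2 M, 0 < M & forall x, `|f x| <= M.
  have [M [_ HM]] := bf; exists (`|M| + 1).
    by rewrite ltr_wpDl.
  by move=> x; apply: HM => //; rewrite (le_lt_trans (ler_norm M))// ltrDl.
have gD x : `|g x| <= D x.
  apply: (@closed_cvg _ _ \oo _ (fun n => `|h n x|) (fun y => y <= D x)).
  - exact: closed_le.
  - exact: nearW.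
  - exact: cvg_norm.
have inth n : mu.-integrable setT (EFin \o h n).
  apply: (le_integrable _ _ _ intD) => //; first by apply/measurable_EFinP; exact: mh.
  by move=> x _ /=; rewrite lee_fin (le_trans (hD n x))// ler_norm.
have intg : mu.-integrable setT (EFin \o g).
  apply: (le_integrable _ _ _ intD) => //; first by apply/measurable_EFinP; exact: mg.
  by move=> x _ /=; rewrite lee_fin (le_trans (gD x))// ler_norm.
have lim (k : R -> R) (K : R) : measurable_fun setT k -> (forall x, `|k x| <= K) ->
    (\int[mu]_x (k x * h n x)) @[n --> \oo] --> (\int[mu]_x (k x * g x)).
  move=> mk kK.
  have K0 : 0 <= K by exact: le_trans (kK 0).
  have intK : mu.-integrable setT (EFin \o (fun x => K * D x)).
    exact: (integrableZl _ K intD).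
  have mkh n : measurable_fun setT (fun x => (k x * h n x)%:E).
    by apply/measurable_EFinP; exact: measurable_funM.
  have mkg : measurable_fun setT (fun x => (k x * g x)%:E).
    by apply/measurable_EFinP; exact: measurable_funM.
  have [||i1 _ i2] := @dominated_convergence _ _ _ mu setT measurableT
    _ _ (fun x => (K * D x)%:E) mkh mkg _ intK.
  - apply: aeW => x _; apply: cvg_EFin; first exact: nearW.
    by apply: cvgMr; exact: hg.
  - apply: aeW => x n _; rewrite /= lee_fin normrM; apply: ler_pM => //.
  apply: fine_cvg; rewrite fineK//.
  exact: (integrable_fin_num _ i1).
have nu_int (nun : {measure set (measurableTypeR R) -> \bar R})
    (q : R -> R) (Cn : R) : mu.-integrable setT (EFin \o q) ->
    (forall U : set R, measurable U -> nun U = \int[mu]_(x in U) (Cn * q x)%:E)%E ->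
    nun setT = 1%E ->
    (\int[nun]_x (f x)%:E = (Cn * \int[mu]_x (f x * q x)%R)%:E)%E.
  move=> intq nunE nun1.
  have mq : measurable_fun setT (fun x => Cn * q x).
    apply: measurable_funM => //; apply/measurable_EFinP.
    exact: measurable_int intq.
  rewrite (integral_density _ mq nunE) ?nun1 ?ltry//; last first.
    by apply: measurable_bounded_integrable => //; rewrite nun1 ltry.
  have intfq : mu.-integrable setT (EFin \o (fun x => f x * q x)).
    apply: (le_integrable _ _ _ (integrableZl _ M intq)) => //.
      apply/measurable_EFinP; apply: measurable_funM => //; apply/measurable_EFinP.
      exact: measurable_int intq.
    move=> x _ /=; rewrite lee_fin !normrM; apply: ler_pM => //.
    by rewrite (le_trans (fM x))// ler_norm.
  rewrite /Rintegral EFinM fineK; last exact: (integrable_fin_num _ intfq).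
  rewrite -integralZl//; apply: eq_integral => x _.
  by rewrite -!EFinM mulrCA.
(* the total mass determines the normalising constant *)
have total (nun : {measure set (measurableTypeR R) -> \bar R})
    (q : R -> R) (Cn : R) :
    (forall U : set R, measurable U -> nun U = \int[mu]_(x in U) (Cn * q x)%:E)%E ->
    mu.-integrable setT (EFin \o q) ->
    nun setT = 1%E -> Cn * \int[mu]_x (1 * q x) = 1.
  move=> nunE intq nun1.
  have := nunE setT measurableT; rewrite nun1.
  under eq_integral do rewrite EFinM.
  rewrite integralZl// => /(congr1 fine)/=.
  rewrite fineM//; last exact: (integrable_fin_num _ intq).
  by move=> e; rewrite [RHS]e; congr (_ * _); apply: eq_Rintegral => x _; rewrite mul1r.
have e1 n : C n * \int[mu]_x (1 * h n x) = 1 by exact: (total _ _ _ (nuE n)).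
have e2 : c * \int[mu]_x (1 * g x) = 1 by exact: (total _ _ _ nu0E).
have inv (u v : R) : u * v = 1 -> u = v^-1.
  by move=> uv; apply/esym/mulr1_eq; rewrite mulrC.
have -> : (fun n => \int[nu n]_x (f x)%:E)%E =
   (fun n => ((\int[mu]_x (1 * h n x))^-1 * \int[mu]_x (f x * h n x))%:E).
  by apply/funext => n; rewrite (nu_int _ _ _ (inth n) (nuE n) (nu1 n)) (inv _ _ (e1 n)).
rewrite (nu_int _ _ _ intg nu0E nu01) (inv _ _ e2).
apply: cvg_EFin; first exact: nearW.
apply: cvgM; last exact: lim.
apply: cvgV; last by apply: (lim (cst 1) 1) => // x; rewrite normr1.
apply/eqP => g0; move: e2; rewrite g0 mulr0 => /esym/eqP.
by rewrite oner_eq0.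
Qed.

End densities.

(** * Second order expansion of the logarithm *)

Section logarithm.
Context {R : realType}.
Implicit Types x c : R.

(** The mean value theorem between 0 and [x], for both signs of [x]. *)
Let mvt0 (g dg : R -> R) x : -1 < x ->
  (forall c, -1 < c -> is_derive c 1 g (dg c)) ->
  exists c, [/\ -1 < c, 0 <= c * x, `|c| <= `|x| & g x - g 0 = dg c * x].
Proof.
move=> x1 dgP.
have cg (a b : R) : -1 < a -> {within `[a, b], continuous g}.
  move=> a1; apply: derivable_within_continuous => y.
  rewrite inE /= ?in_itv/= => /andP[ay _].
  by have [] := dgP y (lt_le_trans a1 ay).
have [x0|x0] := leP 0 x.
  have dg0 y : y \in `]0, x[ -> is_derive y 1 g (dg y).
    rewrite in_itv/= => /andP[y0 _]; apply: dgP.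
    by rewrite (lt_trans _ y0)// ltrN10.
  have [c] := MVT_segment x0 dg0 (cg 0 x (ltrN10 R)).
  rewrite in_itv/= => /andP[c0 cx] e; exists c; split => //.
  - by rewrite (lt_le_trans _ c0)// ltrN10.
  - exact: mulr_ge0.
  - by rewrite !ger0_norm.
  - by rewrite e subr0.
have dg0 y : y \in `]x, 0[ -> is_derive y 1 g (dg y).
  by rewrite in_itv/= => /andP[y0 _]; apply: dgP; exact: lt_trans y0.
have [c] := MVT_segment (ltW x0) dg0 (cg x 0 x1).
rewrite in_itv/= => /andP[c0 cx] e; exists c; split => //.
- exact: lt_le_trans c0.
- by rewrite mulr_le0// ltW.
- by rewrite !ler0_norm ?lerN2// ltW.
- by rewrite -opprB e sub0r mulrN opprK.
Qed.

Let is_derive_ln1D x : -1 < x -> is_derive x 1 (fun y => ln (1 + y)) (1 + x)^-1.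
Proof.
move=> x1; have x0 : 0 < 1 + x by lra.
have d1 : is_derive x 1 (fun y : R => 1 + y) 1.
  by have := is_deriveD (is_derive_cst (1 : R) x 1) (is_derive_id x (1 : R)); rewrite add0r.
have := @is_derive1_comp R (@ln R) (fun y => 1 + y) _ _ _ (is_derive1_ln x0) d1.
by rewrite mulr1.
Qed.

Let is_derive_quad (k x : R) : is_derive x 1 (fun y => y - k * y ^+ 2) (1 - 2 * k * x).
Proof.
have d2 : is_derive x 1 (fun y : R => k * (y * y)) (k * (x + x)).
  have := is_deriveM (is_derive_id x (1 : R)) (is_derive_id x (1 : R)).
  move=> /(is_deriveZ k) H; apply: (is_derive_eq H).
  by rewrite /GRing.scale/= !mulr1.
have := is_deriveB (is_derive_id x (1 : R)) d2.
by move=> H; apply: (is_derive_eq H); ring.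
Qed.

(** The right side minus the left side vanishes at 0 and has the derivative
   [x * ((1 + x)^-1 - (1 + L)^-1)], where the second factor is nonnegative. *)
Lemma ln1D_le (L x : R) : 0 <= L -> -1 < x -> x <= L ->
  ln (1 + x) <= x - (2 * (1 + L))^-1 * x ^+ 2.
Proof.
move=> L0 x1 xL; set k := (2 * (1 + L))^-1.
pose g y : R := (y - k * y ^+ 2) - ln (1 + y).
pose dg y : R := (1 - 2 * k * y) - (1 + y)^-1.
have [|c [c1 cx0 cx e]] := @mvt0 g dg x x1.
  by move=> c c1; exact: is_deriveB (is_derive_quad k c) (is_derive_ln1D c1).
have c0 : 0 < 1 + c by lra.
have g0 : g 0 = 0 by rewrite /g addr0 ln1 expr0n/= mulr0 !subr0.
rewrite -subr_ge0; have -> : x - k * x ^+ 2 - ln (1 + x) = g x - g 0.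
  by rewrite g0 subr0.
have cL : c <= L.
  have [x0|x0] := leP 0 x.
    by rewrite (le_trans (ler_norm c))// (le_trans cx)// ger0_norm.
  by apply: le_trans L0; rewrite -(nmulr_lge0 _ x0).
rewrite e.
have -> : dg c * x = (c * x) * ((1 + c)^-1 - 2 * k).
  rewrite /dg; field; rewrite gt_eqF//.
apply: mulr_ge0 => //; rewrite subr_ge0 /k.
have -> : 2 * (2 * (1 + L))^-1 = (1 + L)^-1.
  by field; rewrite gt_eqF//; lra.
by rewrite lef_pV2 ?posrE//; lra.
Qed.

Let ln1D_cubic x : `|x| <= 2^-1 ->
  `|ln (1 + x) - (x - 2^-1 * x ^+ 2)| <= 2 * `|x| ^+ 3.
Proof.
rewrite ler_norml => /andP[h1 h2].
have x1 : -1 < x by lra.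
pose g y : R := ln (1 + y) - (y - 2^-1 * y ^+ 2).
pose dg y : R := (1 + y)^-1 - (1 - 2 * 2^-1 * y).
have [|c [c1 cx0 cx e]] := @mvt0 g dg x x1.
  by move=> c c1; exact: is_deriveB (is_derive_ln1D c1) (is_derive_quad _ c).
have g0 : g 0 = 0 by rewrite /g addr0 ln1 expr0n/= mulr0 !subr0.
have -> : ln (1 + x) - (x - 2^-1 * x ^+ 2) = g x - g 0 by rewrite g0 subr0.
have cx2 : `|c| <= 2^-1 by rewrite (le_trans cx)// ler_norml h1.
have c0 : 2^-1 <= 1 + c by move: cx2; rewrite ler_norml => /andP[]; lra.
have c00 : 0 < 1 + c by lra.
rewrite e; have -> : dg c = c ^+ 2 * (1 + c)^-1.
  by rewrite /dg; field; rewrite gt_eqF.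
have ic : (1 + c)^-1 <= 2 by rewrite -[leRHS]invrK lef_pV2 ?posrE.
rewrite normrM normrM normrX (@ger0_norm _ (1 + c)^-1) ?invr_ge0 ?(ltW c00)//.
rewrite [leRHS](_ : _ = (`|x| ^+ 2 * 2) * `|x|); last by ring.
apply: ler_wpM2r => //; apply: ler_pM => //; first by rewrite invr_ge0 ltW.
by rewrite ler_pXn2r ?nnegrE.
Qed.

(** Continuous at 0 with this value. The expansion below is an identity for every
   [x], so limits need no estimate of remainders. *)
Definition ln_remainder x : R :=
  if x == 0 then - 2^-1 else (ln (1 + x) - x) / x ^+ 2.

Lemma ln_remainderE x : ln (1 + x) = x + x ^+ 2 * ln_remainder x.
Proof.
rewrite /ln_remainder; case: eqVneq => [->|x0].
  by rewrite addr0 ln1 expr0n/= mul0r addr0.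
by field.
Qed.

Lemma ln_remainder_cvg0 : ln_remainder x @[x --> (0 : R)] --> (- 2^-1 : R).
Proof.
apply/cvgrPdist_le => e e0.
have m0 : 0 < Num.min 2^-1 (e / 2) by rewrite lt_min invr_gt0 ltr0n divr_gt0.
near=> x.
have : `|x| <= Num.min 2^-1 (e / 2).
  near: x; exact: (@nbhs0_le _ R^o _ m0).
rewrite le_min => /andP[h1 h2].
rewrite /ln_remainder; case: eqVneq => [_|x0].
  by rewrite subrr normr0 ltW.
have -> : - 2^-1 - (ln (1 + x) - x) / x ^+ 2 =
  - ((ln (1 + x) - (x - 2^-1 * x ^+ 2)) / x ^+ 2).
  by field.
rewrite normrN normrM normfV ler_pdivrMr; last by rewrite normr_gt0 expf_neq0.
apply: le_trans (ln1D_cubic h1) _.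
rewrite normrX; have : 0 <= `|x| ^+ 2 by rewrite exprn_ge0.
by nra.
Unshelve. all: by end_near. Qed.

End logarithm.

(** * Local limit of Beta laws *)

Section local_limit.
Context {R : realType}.
Notation mu := (@lebesgue_measure R).
Implicit Types p u y z S N : R.

(** Logarithm of the ratio of the values at [p + u] and at the mean [p] of the
   Beta weight with parameters [N * p] and [N * (1 - p)]. *)
Let log_ratio N p u : R :=
  (N * p - 1) * ln (1 + u / p) + (N * (1 - p) - 1) * ln (1 + - u / (1 - p)).

Let beta_weight_ratio N p u : 0 < p < 1 -> 0 < p + u < 1 ->
  beta_weight (N * p) (N * (1 - p)) (p + u) / beta_weight (N * p) (N * (1 - p)) p
  = expR (log_ratio N p u).
Proof.
move=> /andP[p0 p1] /andP[q0 q1].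
have p1' : 0 < 1 - p by lra.
have q1' : 0 < 1 - (p + u) by lra.
rewrite /log_ratio.
have -> : 1 + u / p = (p + u) / p by field; rewrite gt_eqF.
have -> : 1 + - u / (1 - p) = (1 - (p + u)) / (1 - p) by field; rewrite gt_eqF.
rewrite ln_div ?posrE// ln_div ?posrE//.
rewrite /beta_weight /powR !gt_eqF// -!expRD -expRB; congr expR; ring.
Qed.

(** On the range of the two logarithms, [1 + L] is [1 / p] and [1 / (1 - p)] in
   the quadratic bound, and the linear terms cancel up to a bounded quantity. *)
Let log_ratio_le N p u d : 0 < d -> d <= p -> p <= 1 - d -> 1 <= N * d ->
  0 < p + u < 1 -> log_ratio N p u <= 3 / d - N * u ^+ 2.
Proof.
move=> d0 dp pd Nd /andP[q0 q1].
have p0 : 0 < p by lra.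
have p1 : 0 < 1 - p by lra.
have N0 : 0 < N by rewrite -(pmulr_lgt0 _ d0); lra.
set a := p^-1; set b := (1 - p)^-1.
have a0 : 0 < a by rewrite invr_gt0.
have b0 : 0 < b by rewrite invr_gt0.
have ad : a <= d^-1 by rewrite lef_pV2 ?posrE.
have bd : b <= d^-1 by rewrite lef_pV2 ?posrE//; lra.
have h1 : ln (1 + u / p) <= u * a - 2^-1 * u ^+ 2 * a.
  have L0 : 0 <= (1 - p) / p by rewrite divr_ge0 ?ltW.
  have x1 : -1 < u / p by rewrite ltr_pdivlMr//; lra.
  have xL : u / p <= (1 - p) / p by rewrite ler_pM2r ?invr_gt0//; lra.
  apply: (le_trans (ln1D_le L0 x1 xL)).
  rewrite le_eqVlt; apply/orP; left; apply/eqP.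
  by rewrite /a; field; rewrite !gt_eqF//; lra.
have h2 : ln (1 + - u / (1 - p)) <= - u * b - 2^-1 * u ^+ 2 * b.
  have L0 : 0 <= p / (1 - p) by rewrite divr_ge0 ?ltW.
  have x1 : -1 < - u / (1 - p) by rewrite ltr_pdivlMr//; lra.
  have xL : - u / (1 - p) <= p / (1 - p) by rewrite ler_pM2r ?invr_gt0//; lra.
  apply: (le_trans (ln1D_le L0 x1 xL)).
  rewrite le_eqVlt; apply/orP; left; apply/eqP.
  by rewrite /b; field; rewrite !gt_eqF//; lra.
have A0 : 0 <= N * p - 1 by nra.
have B0 : 0 <= N * (1 - p) - 1 by nra.
apply: le_trans (lerD (ler_wpM2l A0 h1) (ler_wpM2l B0 h2)) _.
have -> : (N * p - 1) * (u * a - 2^-1 * u ^+ 2 * a) +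
   (N * (1 - p) - 1) * (- u * b - 2^-1 * u ^+ 2 * b) =
   - N * u ^+ 2 + (u * (b - a) + u ^+ 2 * (2^-1 * (a + b))).
  by rewrite /a /b; field; rewrite !gt_eqF.
rewrite mulNr addrC lerD2r.
have u1 : `|u| <= 1 by rewrite ler_norml; lra.
have u2 : u ^+ 2 <= 1 by rewrite -real_normK ?num_real// expr_le1.
have h3 : u * (b - a) <= d^-1.
  rewrite (le_trans (ler_norm _))// normrM.
  have : `|b - a| <= d^-1 by rewrite ler_norml; lra.
  by have := normr_ge0 u; have := normr_ge0 (b - a); nra.
have h4 : u ^+ 2 * (2^-1 * (a + b)) <= d^-1.
  by have s0 := sqr_ge0 u; nra.
have d1 : 0 < d^-1 by rewrite invr_gt0.
by lra.
Qed.

Let cvg_inv_sqrtn y : y / Num.sqrt n%:R @[n --> \oo] --> (0 : R).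
Proof.
rewrite -(mulr0 y); apply: cvgMr.
have -> : (fun n : nat => (Num.sqrt n%:R)^-1 : R) = fun n => Num.sqrt (n%:R^-1).
  by apply/funext => n; rewrite sqrtrV.
rewrite -(@sqrtr0 R).
exact: (cvg_comp _ _ cvg_invn (@sqrt_continuous R 0)).
Qed.

(** The first order terms [N * u] and [- N * u] cancel; the second order terms
   are [N * u ^+ 2] times the coefficients [- 1 / (2 p)] and [- 1 / (2 (1 - p))]. *)
Let log_ratio_cvg S z (p : nat -> R) y : 0 < z < 1 -> (forall n, 0 < p n < 1) ->
  p n @[n --> \oo] --> z ->
  log_ratio (S + n%:R) (p n) (y / Num.sqrt n%:R) @[n --> \oo] -->
  - (y ^+ 2) / (z * (1 - z) *+ 2).
Proof.
move=> /andP[z0 z1] p01 pz.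
pose u n : R := y / Num.sqrt n%:R.
have u0 : u n @[n --> \oo] --> (0 : R) by exact: cvg_inv_sqrtn.
have z1' : 0 < 1 - z by lra.
have q1 : (p n)^-1 @[n --> \oo] --> z^-1 by apply: cvgV => //; rewrite gt_eqF.
have cq : 1 - p n @[n --> \oo] --> 1 - z by apply: cvgB => //; exact: cvg_cst.
have q2 : (1 - p n)^-1 @[n --> \oo] --> (1 - z)^-1.
  by apply: cvgV => //; rewrite gt_eqF.
have x1 : u n / p n @[n --> \oo] --> (0 : R).
  by rewrite -(mul0r (z^-1)); exact: cvgM.
have x2 : - u n / (1 - p n) @[n --> \oo] --> (0 : R).
  by have h := cvgM (cvgN u0) q2; rewrite oppr0 mul0r in h; exact: h.
have r1 := cvg_comp _ _ x1 (@ln_remainder_cvg0 R).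
have r2 := cvg_comp _ _ x2 (@ln_remainder_cvg0 R).
have lnc : ln (1 + x) @[x --> (0 : R)] --> (0 : R).
  have c1 : 1 + x @[x --> (0 : R)] --> (1 : R).
    by rewrite -[X in _ --> X]addr0; apply: cvgD; [exact: cvg_cst|exact: cvg_id].
  by have := cvg_comp _ _ c1 (@continuous_ln R 1 ltr01); rewrite ln1.
have l1 := cvg_comp _ _ x1 lnc.
have l2 := cvg_comp _ _ x2 lnc.
have e n : log_ratio (S + n%:R) (p n) (u n) =
  (S + n%:R) * u n ^+ 2 * (ln_remainder (u n / p n) / p n +
     ln_remainder (- u n / (1 - p n)) / (1 - p n))
  - ln (1 + u n / p n) - ln (1 + - u n / (1 - p n)).
  have /andP[pn0 pn1] := p01 n.
  rewrite /log_ratio; set l1' := ln _; set l2' := ln _.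
  set t1 := ln_remainder _; set t2 := ln_remainder _.
  have k1 : p n * l1' = u n + u n ^+ 2 * (t1 / p n).
    by rewrite /l1' ln_remainderE -/t1; field; rewrite gt_eqF.
  have k2 : (1 - p n) * l2' = - u n + u n ^+ 2 * (t2 / (1 - p n)).
    by rewrite /l2' ln_remainderE -/t2; field; rewrite gt_eqF//; lra.
  transitivity ((S + n%:R) * (p n * l1' + (1 - p n) * l2') - l1' - l2'); first by ring.
  by rewrite k1 k2; ring.
have Nu : (S + n%:R) * u n ^+ 2 @[n --> \oo] --> y ^+ 2.
  have -> : y ^+ 2 = S * y ^+ 2 * 0 + y ^+ 2 by rewrite mulr0 add0r.
  apply: (@cvg_trans _ ((S * y ^+ 2 * n%:R^-1 + y ^+ 2) @[n --> \oo])); last first.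
    by apply: cvgD; [apply: cvgMr; exact: cvg_invn|exact: cvg_cst].
  apply: near_eq_cvg; near=> n.
  rewrite /u expr_div_n sqr_sqrtr//.
  have n0 : n%:R != 0 :> R by rewrite pnatr_eq0 -lt0n; near: n; exists 1%N.
  by field.
have -> : (fun n => log_ratio (S + n%:R) (p n) (y / Num.sqrt n%:R)) =
  (fun n => (S + n%:R) * u n ^+ 2 * (ln_remainder (u n / p n) / p n +
     ln_remainder (- u n / (1 - p n)) / (1 - p n))
  - ln (1 + u n / p n) - ln (1 + - u n / (1 - p n))).
  by apply/funext => n; exact: e.
have -> : - (y ^+ 2) / (z * (1 - z) *+ 2) =
  y ^+ 2 * (- 2^-1 / z + - 2^-1 / (1 - z)) - 0 - 0.
  by field; rewrite !gt_eqF.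
apply: cvgB; last exact: l2.
apply: cvgB; last exact: l1.
apply: cvgM => //; apply: cvgD; apply: cvgM => //.
Unshelve. all: by end_near. Qed.

Let weak_cvg_shift (nu : nat -> {measure set (measurableTypeR R) -> \bar R})
    (nu0 : {measure set (measurableTypeR R) -> \bar R}) m :
  weak_cvg (fun n => nu (n + m)%N) nu0 -> weak_cvg nu nu0.
Proof.
move=> h f cf bf; rewrite -(cvg_shiftn m); exact: h.
Qed.

Let normal_prob_centered s2 (U : set R) : 0 < s2 ->
  centered_normal s2 U = (\int[mu]_(x in U)
    (normal_peak (Num.sqrt s2) * expR (- (x ^+ 2) / (s2 *+ 2)))%:E)%E.
Proof.
move=> s0; rewrite /centered_normal s0 /= /normal_prob.
apply: eq_integral => x _; rewrite normal_pdfE ?gt_eqF ?sqrtr_gt0//.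
by rewrite /normal_fun subr0 sqr_sqrtr// ltW.
Qed.

(** The density of the rescaled Beta law is a constant times the exponential of
   [log_ratio]; this converges to the unnormalised normal density and is
   dominated by a multiple of [gauss_fun]. *)
Lemma beta_local_limit S z (p : nat -> R)
    (nu : nat -> {measure set (measurableTypeR R) -> \bar R}) :
  0 < S -> 0 < z < 1 -> (forall n, 0 < p n < 1) -> p n @[n --> \oo] --> z ->
  (forall n (U : set R), measurable U ->
    nu n U = beta_law ((S + n%:R) * p n) ((S + n%:R) * (1 - p n))
      [set x | U (Num.sqrt n%:R * (x - p n))]) ->
  weak_cvg nu (centered_normal (z * (1 - z))).
Proof.
move=> S0 z01 p01 pz nuE.
have /andP[z0 z1] := z01.
pose d := Num.min (z / 2) ((1 - z) / 2).
have d0 : 0 < d by rewrite lt_min !divr_gt0// subr_gt0.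
have [dz d1z] : d <= z / 2 /\ d <= (1 - z) / 2.
  by split; rewrite ge_min lexx ?orbT.
have [m m0 Hm] : exists2 m, (0 < m)%N &
    forall n, (m <= n)%N -> [/\ d <= p n, p n <= 1 - d & 1 <= (S + n%:R) * d].
  move/cvgrPdist_le: (pz) => /(_ _ d0) [m1 _ Hm1].
  have [m2 Hm2] : exists m2 : nat, d^-1 <= m2%:R.
    exists (Num.truncn d^-1).+1; rewrite ltW//.
    by rewrite truncnS_gt.
  exists (maxn 1 (maxn m1 m2)); first by rewrite leq_max.
  move=> n; rewrite !geq_max => /and3P[n1 nm1 nm2].
  have := Hm1 n nm1; rewrite ler_norml => /andP[h1 h2].
  split; [lra|lra|].
  have : d^-1 <= S + n%:R.
    by rewrite (le_trans Hm2)// (@le_trans _ _ n%:R) ?ler_nat// lerDr ltW.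
  by rewrite -(ler_pM2r d0) mulVf ?gt_eqF.
(* the domination only holds from the index [m] on *)
apply: (@weak_cvg_shift _ _ m).
pose th n y : R := p n + y / Num.sqrt n%:R.
pose h n y : R := if th n y \in `]0, 1[ then
   expR (log_ratio (S + n%:R) (p n) (y / Num.sqrt n%:R)) else 0.
pose C n : R := (Num.sqrt n%:R)^-1 *
  (beta_weight ((S + n%:R) * p n) ((S + n%:R) * (1 - p n)) (p n) /
   beta_norm ((S + n%:R) * p n) ((S + n%:R) * (1 - p n))).
have N0 n : 0 < S + n%:R by rewrite ltr_wpDr.
have ab0 n : 0 < (S + n%:R) * p n /\ 0 < (S + n%:R) * (1 - p n).
  have /andP[p0 p1] := p01 n.
  by rewrite !mulr_gt0// subr_gt0.
have dens n y : (Num.sqrt n%:R)^-1 *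
    beta_density ((S + n%:R) * p n) ((S + n%:R) * (1 - p n)) (th n y) = C n * h n y.
  rewrite /C /h /beta_density; case: ifPn => [|_]; last by rewrite !mulr0.
  rewrite in_itv/= => th01.
  rewrite -beta_weight_ratio//.
  have w0 : 0 < beta_weight ((S + n%:R) * p n) ((S + n%:R) * (1 - p n)) (p n).
    by apply: beta_weight_gt0; rewrite in_itv/= p01.
  have [a0 b0] := ab0 n.
  have B0 := beta_norm_gt0 a0 b0.
  rewrite /th -[RHS]mulrA; congr (_ * _); move: w0 B0.
  set w1 := beta_weight _ _ (p n); set B := beta_norm _ _; set w2 := beta_weight _ _ _.
  by move=> w0 B0; rewrite -[RHS]mulrA [B^-1 * _]mulrC mulrA mulrCA mulfV ?gt_eqF// mulr1.
have mth n : measurable_fun setT (th n).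
  by apply: measurable_funD => //; exact: measurable_funM.
have C_gt0 n : 0 < C (n + m)%N /\ 0 < Num.sqrt ((n + m)%:R : R).
  have s0 : 0 < Num.sqrt ((n + m)%:R : R).
    by rewrite sqrtr_gt0 ltr0n addn_gt0 m0 orbT.
  have [a0 b0] := ab0 (n + m)%N.
  split => //; rewrite /C mulr_gt0 ?invr_gt0// divr_gt0 ?beta_norm_gt0//.
  by apply: beta_weight_gt0; rewrite in_itv/= p01.
apply: (@weak_cvg_density _ (fun n => h (n + m)%N)
  (fun y => expR (- (y ^+ 2) / (z * (1 - z) *+ 2)))
  (fun y => expR (3 / d) * gauss_fun y) (fun n => C (n + m)%N)
  (normal_peak (Num.sqrt (z * (1 - z))))).
- move=> n; have [C0 _] := C_gt0 n.
  have -> : h (n + m)%N = fun y => (C (n + m)%N)^-1 * ((Num.sqrt (n + m)%:R)^-1 *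
    beta_density ((S + (n + m)%:R) * p (n + m)%N)
      ((S + (n + m)%:R) * (1 - p (n + m)%N)) (th (n + m)%N y)).
    by apply/funext => y; rewrite dens mulKf ?gt_eqF.
  apply: measurable_funM => //; apply: measurable_funM => //.
  exact: (measurableT_comp (measurable_beta_density _ _) (mth _)).
- have -> : (fun y => expR (- y ^+ 2 / (z * (1 - z) *+ 2))) =
    normal_fun 0 (Num.sqrt (z * (1 - z))).
    apply/funext => y; rewrite /normal_fun subr0 sqr_sqrtr// ltW//.
    by rewrite mulr_gt0// subr_gt0.
  exact: measurable_normal_fun.
- move=> n y; rewrite /h; case: ifPn => [|_]; last first.
    by rewrite normr0 mulr_ge0 ?expR_ge0// gauss_fun_ge0.
  rewrite in_itv/= => th01.
  have [h1 h2 h3] := Hm _ (leq_addl n m).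
  rewrite ger0_norm ?expR_ge0// /gauss_fun -expRD ler_expR.
  apply: le_trans (log_ratio_le d0 h1 h2 h3 th01) _.
  rewrite lerD2l lerN2 expr_div_n sqr_sqrtr// mulrCA ler_peMr ?sqr_ge0//.
  have nm0 : 0 < (n + m)%:R :> R by rewrite ltr0n addn_gt0 m0 orbT.
  by rewrite ler_pdivlMr// mul1r lerDr ltW.
- have := integrableZl measurableT (expR (3 / d)) (@integrableT_gauss R).
  exact.
- move=> y; rewrite (cvg_shiftn m (fun n => h n y)).
  have thz : th n y @[n --> \oo] --> z.
    by rewrite -(addr0 z); apply: cvgD => //; exact: cvg_inv_sqrtn.
  have th01 : \forall n \near \oo, th n y \in `]0, 1[.
    have z01' : z \in `]0, 1[ by rewrite in_itv/= z0 z1.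
    exact: (thz _ (near_in_itvoo z01')).
  apply: (@cvg_trans _ (expR (log_ratio (S + n%:R) (p n) (y / Num.sqrt n%:R)) @[n --> \oo])).
    apply: near_eq_cvg; near=> n; rewrite /h ifT//.
    by near: n.
  have := @log_ratio_cvg S z p y z01 p01 pz.
  move/cvg_comp; apply; exact: continuous_expR.
- move=> n U mU; have [_ s0] := C_gt0 n.
  rewrite nuE// beta_lawE.
  have [a0 b0] := ab0 (n + m)%N.
  transitivity (\int[mu]_(x in (fun x => Num.sqrt (n + m)%:R * (x - p (n + m)%N))%R @^-1` U)
    (beta_density ((S + (n + m)%:R) * p (n + m)%N)
      ((S + (n + m)%:R) * (1 - p (n + m)%N)) x)%:E)%E; first by [].
  rewrite integral_affine//; last 2 first.
  - exact: measurable_beta_density.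
  - exact: beta_density_ge0.
  by apply: eq_integral => y _; rewrite -dens.
- move=> U mU; apply: normal_prob_centered.
  by rewrite mulr_gt0// subr_gt0.
- move=> n; by rewrite nuE// beta_lawT//; have [] := ab0 (n + m)%N.
- exact: probability_setT.
Unshelve. all: by end_near. Qed.

End local_limit.

(** * The urn as a Beta mixture of coin tosses *)

Section beta_mixture.
Context {R : realType}.
Notation mu := (@lebesgue_measure R).
Implicit Types (g : R -> R -> R) (a b x L : R).

(** Mean of [g] over the masses reached [n] draws after [(a, b)]. It is defined
   by conditioning on the first of these draws, not as a sum over trajectories,
   so that its properties follow by induction on [n]. *)
Fixpoint urn_mean g n a b : R :=
  if n is n'.+1 then
    a / (a + b) * urn_mean g n' (a + 1) b + b / (a + b) * urn_mean g n' a (b + 1)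
  else g a b.

(** The same mean when each draw is black with the fixed probability [x]. *)
Fixpoint coin_mean g n a b x : R :=
  if n is n'.+1 then
    x * coin_mean g n' (a + 1) b x + (1 - x) * coin_mean g n' a (b + 1) x
  else g a b.

Let measurable_coin_mean g n a b : measurable_fun setT (coin_mean g n a b).
Proof.
elim: n a b => [|n IHn] a b /=; first exact: measurable_cst.
apply: measurable_funD; apply: measurable_funM => //.
exact: measurable_funB.
Qed.

Let coin_mean_itv g n a b x : x \in `]0, 1[ -> (forall y z, 0 <= g y z <= 1) ->
  0 <= coin_mean g n a b x <= 1.
Proof.
rewrite in_itv/= => /andP[x0 x1] g01; elim: n a b => [|n IHn] a b //=.
have /andP[h1 h2] := IHn (a + 1) b; have /andP[h3 h4] := IHn a (b + 1).
by apply/andP; split; nra.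
Qed.

Let beta_densitySl a b x : 0 < a -> 0 < b ->
  x * beta_density a b x = a / (a + b) * beta_density (a + 1) b x.
Proof.
move=> a0 b0; have [x01|x01] := boolP (x \in `]0, 1[); last first.
  by rewrite /beta_density (negbTE x01) mulr0 mulr0.
rewrite /beta_density x01 (beta_weightSl _ _ x01).
have B0 := beta_norm_gt0 a0 b0.
have B1 : 0 < beta_norm (a + 1) b by rewrite beta_norm_gt0// addr_gt0.
have s0 : 0 < a + b by rewrite addr_gt0.
have e : a * beta_norm a b = (a + b) * beta_norm (a + 1) b.
  by rewrite (beta_norm_split a0 b0) mulrDr beta_norm_parts// -mulrDl.
have -> : beta_norm a b = (a + b) / a * beta_norm (a + 1) b.
  by apply: (mulfI (lt0r_neq0 a0)); rewrite e; field; rewrite gt_eqF.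
by field; rewrite !gt_eqF.
Qed.

Let beta_densitySr a b x : 0 < a -> 0 < b ->
  (1 - x) * beta_density a b x = b / (a + b) * beta_density a (b + 1) x.
Proof.
move=> a0 b0; have [x01|x01] := boolP (x \in `]0, 1[); last first.
  by rewrite /beta_density (negbTE x01) mulr0 mulr0.
rewrite /beta_density x01 (beta_weightSr _ _ x01).
have B0 := beta_norm_gt0 a0 b0.
have B1 : 0 < beta_norm a (b + 1) by rewrite beta_norm_gt0// addr_gt0.
have s0 : 0 < a + b by rewrite addr_gt0.
have e : b * beta_norm a b = (a + b) * beta_norm a (b + 1).
  by rewrite (beta_norm_split a0 b0) mulrDr -beta_norm_parts// -mulrDl addrC.
have -> : beta_norm a b = (a + b) / b * beta_norm a (b + 1).
  by apply: (mulfI (lt0r_neq0 b0)); rewrite e; field; rewrite gt_eqF.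
by field; rewrite !gt_eqF.
Qed.

Let weighted_mean_ge0 g n a b x : 0 < a -> 0 < b -> (forall y z, 0 <= g y z <= 1) ->
  0 <= beta_density a b x * coin_mean g n a b x.
Proof.
move=> a0 b0 g01; have [x01|x01] := boolP (x \in `]0, 1[).
  have /andP[h _] := coin_mean_itv n a b x01 g01.
  by rewrite mulr_ge0// beta_density_ge0.
by rewrite /beta_density (negbTE x01) mul0r.
Qed.

(** De Finetti's representation: the urn is a mixture of coin tosses over a Beta
   distributed success probability. The induction only uses that multiplying the
   density by [x] or by [1 - x] raises a parameter, at the price of the factor
   [a / (a + b)] or [b / (a + b)]. *)
Lemma urn_mean_mixture g n a b : 0 < a -> 0 < b -> (forall y z, 0 <= g y z <= 1) ->
  (urn_mean g n a b)%:E = (\int[mu]_x (beta_density a b x * coin_mean g n a b x)%:E)%E.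
Proof.
move=> + + g01; elim: n a b => [|n IHn] a b a0 b0 /=.
  under eq_integral do rewrite EFinM.
  rewrite ge0_integralZr//.
  - have := beta_lawT a0 b0; rewrite beta_lawE => ->; by rewrite mul1e.
  - by apply/measurable_EFinP; exact: measurable_beta_density.
  - by move=> x _; rewrite lee_fin beta_density_ge0.
  - by rewrite lee_fin; have /andP[] := g01 a b.
have a10 : 0 < a + 1 by rewrite addr_gt0.
have b10 : 0 < b + 1 by rewrite addr_gt0.
have s0 : 0 <= a + b by rewrite ltW// addr_gt0.
have m (u v : R) : measurable_fun setT
    (fun x => (beta_density u v x * coin_mean g n u v x)%:E).
  apply/measurable_EFinP; apply: measurable_funM; first exact: measurable_beta_density.
  exact: measurable_coin_mean.
transitivity (\int[mu]_x ((a / (a + b))%:E *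
     (beta_density (a + 1) b x * coin_mean g n (a + 1) b x)%:E +
   (b / (a + b))%:E *
     (beta_density a (b + 1) x * coin_mean g n a (b + 1) x)%:E))%E; last first.
  apply: eq_integral => x _; rewrite -!EFinM -EFinD; congr (_%:E).
  rewrite !mulrA -beta_densitySl// -beta_densitySr//; ring.
rewrite ge0_integralD//; last 4 first.
- by move=> x _; rewrite -EFinM lee_fin mulr_ge0 ?divr_ge0 ?weighted_mean_ge0// ltW.
- by apply: measurable_funeM; exact: m.
- by move=> x _; rewrite -EFinM lee_fin mulr_ge0 ?divr_ge0 ?weighted_mean_ge0// ltW.
- by apply: measurable_funeM; exact: m.
rewrite !ge0_integralZl//; last 6 first.
- exact: m.
- by move=> x _; rewrite lee_fin weighted_mean_ge0.
- by rewrite lee_fin divr_ge0// ltW.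
- exact: m.
- by move=> x _; rewrite lee_fin weighted_mean_ge0.
- by rewrite lee_fin divr_ge0// ltW.
by rewrite -!IHn// -!EFinM -EFinD.
Qed.

(** Bernstein's argument. The quantity [a * (1 - x) - b * x] is [a + b] times the
   difference between the proportion and [x]; a toss adds [1 - x] or [- x] to
   it, hence [x * (1 - x)] to its mean square. The bound [t <= e + t ^+ 2 / e]
   turns the mean square into a bound for the mean distance. *)
Let coin_mean_lipschitz (f : R -> R) L x e n a b : 0 < e -> 0 <= L ->
  (forall y z, `|f y - f z| <= L * `|y - z|) -> 0 <= x <= 1 -> 0 < a -> 0 < b ->
  `|coin_mean (fun y z => f (y / (y + z))) n a b x - f x| <=
  L * (e + (n%:R * (x * (1 - x)) + (a * (1 - x) - b * x) ^+ 2) /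
           (e * (a + b + n%:R) ^+ 2)).
Proof.
move=> e0 L0 fL /andP[x0 x1]; elim: n a b => [|n IHn] a b a0 b0 /=.
  apply: le_trans (fL _ _) _; apply: ler_wpM2l => //.
  rewrite mul0r add0r addr0; have s0 : 0 < a + b by rewrite addr_gt0.
  have -> : a / (a + b) - x = (a * (1 - x) - b * x) / (a + b).
    by field; rewrite gt_eqF.
  set D := _ - b * x; rewrite normrM normfV (gtr0_norm s0).
  have -> : D ^+ 2 / (e * (a + b) ^+ 2) = (`|D| / (a + b)) ^+ 2 / e.
    by rewrite expr_div_n real_normK ?num_real//; field; rewrite !gt_eqF.
  set t := `|D| / (a + b).
  have [te|te] := leP t e; first by rewrite (le_trans te)// lerDl divr_ge0 ?sqr_ge0// ltW.
  have : t <= t ^+ 2 / e.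
    by rewrite ler_pdivlMr// expr2 ler_pM2l ?(ltW te)// (lt_trans e0).
  by move=> h; rewrite (le_trans h)// lerDr ltW.
set g := (X in coin_mean X).
have a10 : 0 < a + 1 by rewrite addr_gt0.
have b10 : 0 < b + 1 by rewrite addr_gt0.
have x1' : 0 <= 1 - x by rewrite subr_ge0.
have -> : x * coin_mean g n (a + 1) b x + (1 - x) * coin_mean g n a (b + 1) x - f x =
  x * (coin_mean g n (a + 1) b x - f x) +
  (1 - x) * (coin_mean g n a (b + 1) x - f x) by ring.
apply: le_trans (ler_normD _ _) _; rewrite !normrM (ger0_norm x0) (ger0_norm x1').
apply: le_trans (lerD (ler_wpM2l x0 (IHn _ _ a10 b0)) (ler_wpM2l x1' (IHn _ _ a0 b10))) _.
have e1 : a + 1 + b + n%:R = a + b + n.+1%:R by rewrite -natr1; ring.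
have e2 : a + (b + 1) + n%:R = a + b + n.+1%:R by rewrite -natr1; ring.
rewrite e1 e2 le_eqVlt; apply/orP; left; apply/eqP.
by rewrite -!natr1; ring.
Qed.

Let coin_mean_cvg (f : R -> R) L x a b : 0 <= L ->
  (forall y z, `|f y - f z| <= L * `|y - z|) -> 0 <= x <= 1 -> 0 < a -> 0 < b ->
  coin_mean (fun y z => f (y / (y + z))) n a b x @[n --> \oo] --> f x.
Proof.
move=> L0 fL x01 a0 b0.
pose K : R := 1 + (a * (1 - x) - b * x) ^+ 2.
have K0 : 0 <= K by rewrite addr_ge0 ?sqr_ge0.
apply/cvgrPdist_le => e e0.
pose h := e / (2 * (L + 1)).
have L10 : 0 < L + 1 by rewrite ltr_wpDl.
have h0 : 0 < h by rewrite divr_gt0 ?mulr_gt0.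
have : K / h * n%:R^-1 @[n --> \oo] --> (0 : R).
  by rewrite -[X in _ --> X](mulr0 (K / h)); apply: cvgMr; exact: cvg_invn.
move=> /cvgrPdist_le /(_ _ h0) [n0 _ Hn]; exists n0.+1 => // n n0n.
have nR : 0 < n%:R :> R by rewrite ltr0n (leq_trans _ n0n).
rewrite distrC; apply: le_trans (coin_mean_lipschitz n h0 L0 fL x01 a0 b0) _.
set q := _ / (h * _).
have qh : q <= h.
  have := Hn n (ltnW n0n); rewrite sub0r normrN ger0_norm; last first.
    by rewrite mulr_ge0 ?invr_ge0// divr_ge0// ltW.
  apply: le_trans.
  have s0 : 0 < a + b + n%:R by rewrite ltr_wpDr// addr_gt0.
  rewrite /q invfM mulrCA [leLHS]mulrC [leRHS]mulrAC ler_wpM2r ?invr_ge0 ?(ltW h0)//.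
  rewrite ler_pdivrMr ?exprn_gt0// mulrAC ler_pdivlMr//.
  have sn : n%:R <= a + b + n%:R by rewrite lerDr addr_ge0// ltW.
  have n1 : 1 <= n%:R :> R by rewrite ler1n -(ltr0n R).
  have hx : x * (1 - x) <= 1 by case/andP: x01 => x0 x1; nra.
  have hs : n%:R ^+ 2 <= (a + b + n%:R) ^+ 2 by rewrite ler_pXn2r ?nnegrE// ltW.
  apply: (@le_trans _ _ (K * n%:R ^+ 2)); last exact: ler_wpM2l.
  rewrite [n%:R ^+ 2]expr2 [leRHS]mulrA ler_wpM2r//.
  rewrite /K mulrDl mul1r; apply: lerD; first by rewrite ler_piMr.
  by rewrite ler_peMr// sqr_ge0.
have q0 : 0 <= q.
  case/andP: x01 => x0 x1; rewrite /q divr_ge0//; last first.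
    by rewrite mulr_ge0 ?exprn_ge0 ?addr_ge0 ?(ltW h0) ?(ltW a0) ?(ltW b0).
  by rewrite addr_ge0 ?sqr_ge0// !mulr_ge0// subr_ge0.
apply: (@le_trans _ _ ((L + 1) * (h + h))).
  apply: ler_pM => //; [|by rewrite lerDl|by rewrite lerD2l].
  by rewrite addr_ge0// ltW.
by rewrite le_eqVlt; apply/orP; left; apply/eqP; rewrite /h; field; rewrite gt_eqF.
Qed.

Lemma integrable_beta_density a b : 0 < a -> 0 < b ->
  mu.-integrable setT (EFin \o beta_density a b).
Proof.
move=> a0 b0; apply/integrableP; split.
  by apply/measurable_EFinP; exact: measurable_beta_density.
under eq_integral do rewrite /= ger0_norm ?beta_density_ge0//.
by have := beta_lawT a0 b0; rewrite beta_lawE => ->; rewrite ltry.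
Qed.

Lemma urn_mean_cvg (f : R -> R) L a b : 0 <= L ->
  (forall y z, `|f y - f z| <= L * `|y - z|) -> (forall y, 0 <= f y <= 1) ->
  0 < a -> 0 < b ->
  (urn_mean (fun y z => f (y / (y + z))) n a b)%:E @[n --> \oo] -->
  (\int[mu]_x (beta_density a b x * f x)%:E)%E.
Proof.
move=> L0 fL f01 a0 b0; pose g := fun y z : R => f (y / (y + z)); rewrite -/g.
have g01 y z : 0 <= g y z <= 1 by exact: f01.
have mf : measurable_fun setT f.
  by apply: continuous_measurable_fun; exact: lipschitz_continuous fL.
under eq_fun do rewrite urn_mean_mixture//.
have mdc n : measurable_fun setT (fun x => (beta_density a b x * coin_mean g n a b x)%:E).
  apply/measurable_EFinP; apply: measurable_funM; first exact: measurable_beta_density.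
  exact: measurable_coin_mean.
have mdf : measurable_fun setT (fun x => (beta_density a b x * f x)%:E).
  apply/measurable_EFinP; apply: measurable_funM => //.
  exact: measurable_beta_density.
have [||_ _] := @dominated_convergence _ _ _ mu setT measurableT _ _
  (EFin \o beta_density a b) mdc mdf _ (integrable_beta_density a0 b0).
- apply: aeW => x _; apply: cvg_EFin; first exact: nearW.
  have [x01|x01] := boolP (x \in `]0, 1[).
    apply: cvgMr; apply: (coin_mean_cvg L0) => //.
    by move: x01; rewrite in_itv/= => /andP[h1 h2]; rewrite !ltW.
  rewrite /= /beta_density (negbTE x01) mul0r.
  by under eq_fun do rewrite /= mul0r; exact: cvg_cst.
- apply: aeW => x n _; rewrite /= lee_fin.
  have [x01|x01] := boolP (x \in `]0, 1[).
    have /andP[h1 h2] := coin_mean_itv n a b x01 g01.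
    by rewrite ger0_norm ?mulr_ge0 ?beta_density_ge0// ler_piMr ?beta_density_ge0.
  by rewrite /beta_density (negbTE x01) mul0r normr0.
exact.
Qed.

End beta_mixture.
(** * The proportion of black balls *)

Section urn_process.
Context {R : realType} {d : measure_display} {T : measurableType d}.
Variables (P : probability T R) (b r c : nat) (X : nat -> {RV P >-> bool}).
Hypotheses (hb : (1 <= b)%N) (hr : (1 <= r)%N) (hc : (1 <= c)%N).
Hypothesis urn : polya_urn b r c X.

Local Notation Z := (black_ratio b r c X).
Local Notation F n := (<<s first_draws X n >>).

(** Masses are counted in units of [c] balls: a draw adds 1 to one of them. *)
Definition black_mass n w : R := (black b c X n w)%:R / c%:R.
Definition red_mass n w : R := (red r c X n w)%:R / c%:R.

Let c0 : (c%:R : R) != 0. Proof. by rewrite pnatr_eq0 -lt0n. Qed.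

Let black_massS n w : black_mass n.+1 w = black_mass n w + (X n w)%:R.
Proof.
rewrite /black_mass /black big_ord_recr/= mulnDr addnA natrD natrM.
by rewrite mulrDl [c%:R * _]mulrC mulfK.
Qed.

Let red_massS n w : red_mass n.+1 w = red_mass n w + (~~ X n w)%:R.
Proof.
rewrite /red_mass /red big_ord_recr/= mulnDr addnA natrD natrM.
by rewrite mulrDl [c%:R * _]mulrC mulfK.
Qed.

Let black_mass_gt0 n w : 0 < black_mass n w.
Proof. by rewrite divr_gt0 ?ltr0n// /black addn_gt0 hb. Qed.

Let red_mass_gt0 n w : 0 < red_mass n w.
Proof. by rewrite divr_gt0 ?ltr0n// /red addn_gt0 hr. Qed.

Let mass_gt0 : 0 < (b + r)%:R / c%:R :> R.
Proof. by rewrite divr_gt0 ?ltr0n// addn_gt0 hb. Qed.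

Lemma total_mass n w :
  black_mass n w + red_mass n w = (b + r)%:R / c%:R + n%:R.
Proof.
elim: n => [|n IHn].
  rewrite /black_mass /red_mass /black /red !big_ord0 !muln0 !addn0.
  by rewrite -mulrDl -natrD addr0.
rewrite black_massS red_massS addrACA IHn -addrA -natr1; congr (_ + (_ + _)).
by case: (X n w); rewrite /= ?addr0 ?add0r.
Qed.

Lemma black_ratioE n w :
  Z n w = black_mass n w / (black_mass n w + red_mass n w).
Proof.
rewrite /black_ratio /black_mass /red_mass -mulrDl -natrD invfM invrK.
by rewrite mulrACA mulVf// mulr1.
Qed.

Let first_drawsS m n : (m <= n)%N -> F m `<=` F n.
Proof.
move=> mn; apply: sub_sigma_algebra2 => A [i /= im Ai].
by exists i => //=; exact: leq_trans im mn.
Qed.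

Let draw_in n (e : bool) : F n.+1 [set w | X n w = e].
Proof.
apply: sub_sigma_algebra; exists n => //=.
by exists [set e] => //; rewrite setTI.
Qed.

Let measurable_F n A : F n A -> measurable A.
Proof.
suff : F n `<=` measurable by exact.
apply: smallest_sub; first exact: sigma_algebra_measurable.
move=> B [i _ [Y mY <-]].
exact: measurable_funP.
Qed.

Let F_I n A B : F n A -> F n B -> F n (A `&` B).
Proof.
move=> FA FB.
have := @measurableI _ (g_sigma_algebraType (first_draws X n)) A B FA FB.
exact.
Qed.

(** Events on which the urn restarts: they are decided by the first [m] draws and
   determine the contents of the urn. Intersecting such an event with the next
   draw gives one for [m.+1], which is what all inductions below use. *)
Definition at_state m (a a' : R) (A : set T) :=
  F m A /\ forall w, A w -> black_mass m w = a /\ red_mass m w = a'.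

Let at_state_black m a a' A : at_state m a a' A ->
  at_state m.+1 (a + 1) a' (A `&` [set w | X m w = true]).
Proof.
move=> [FA Aa]; split.
  by apply: F_I; [exact: first_drawsS FA|exact: draw_in].
by move=> w [/Aa [<- <-] /= Xw]; rewrite black_massS red_massS Xw addr0.
Qed.

Let at_state_red m a a' A : at_state m a a' A ->
  at_state m.+1 a (a' + 1) (A `&` [set w | X m w = false]).
Proof.
move=> [FA Aa]; split.
  by apply: F_I; [exact: first_drawsS FA|exact: draw_in].
by move=> w [/Aa [<- <-] /= Xw]; rewrite black_massS red_massS Xw addr0.
Qed.

Let draw_cases (A : set T) m : A = (A `&` [set w | X m w = true]) `|`
  (A `&` [set w | X m w = false]).
Proof.
rewrite -setIUr; apply/esym/setIidPl => w _ /=.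
by case: (X m w); [left|right].
Qed.

Let draw_disj (A : set T) m : [disjoint (A `&` [set w | X m w = true]) &
  (A `&` [set w | X m w = false])].
Proof.
by apply/disj_setPS => w [[_ /= ->] [_]].
Qed.

Lemma prob_black m a a' A : at_state m a a' A ->
  P (A `&` [set w | X m w = true]) = (P A * (a / (a + a'))%:E)%E.
Proof.
move=> [FA Aa]; rewrite urn//.
under eq_integral => w wA.
  rewrite black_ratioE; have [|-> ->] := Aa w; first by rewrite inE in wA.
  over.
by rewrite integral_cst 1?muleC//; exact: measurable_F FA.
Qed.

Lemma prob_red m a a' A : 0 < a -> 0 < a' -> at_state m a a' A ->
  P (A `&` [set w | X m w = false]) = (P A * (a' / (a + a'))%:E)%E.
Proof.
move=> a0 a'0 sA; have [FA _] := sA.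
have mA := measurable_F FA.
have := prob_black sA.
have m1 := measurable_F (at_state_black sA).1.
have m2 := measurable_F (at_state_red sA).1.
have : P A = (P (A `&` [set w | X m w = true]) +
  P (A `&` [set w | X m w = false]))%E.
  rewrite {1}(draw_cases A m) measureU//; apply/eqP; rewrite -disj_set2E.
  exact: draw_disj.
have f1 := fin_num_measure P _ m1; have f2 := fin_num_measure P _ m2.
have f3 := fin_num_measure P _ mA.
rewrite -(fineK f1) -(fineK f2) -(fineK f3) -EFinD -!EFinM => -[->] [] h.
congr (_%:E); move: h; set u := fine _; set v := fine _ => h.
have s0 : a + a' != 0 by rewrite gt_eqF// addr_gt0.
have : v * a = u * a' by move: h => /(congr1 (fun x => x * (a + a'))); rewrite mulrA divfK//; lra.
move=> k; rewrite mulrA; apply: (mulIf s0); rewrite divfK//; lra.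
Qed.

Let at_state_P m a a' A : 0 < a -> 0 < a' -> at_state m a a' A ->
  exists2 u, 0 <= u & [/\ P A = u%:E,
    P (A `&` [set w | X m w = true]) = (u * (a / (a + a')))%:E &
    P (A `&` [set w | X m w = false]) = (u * (a' / (a + a')))%:E].
Proof.
move=> a0 a'0 sA; have mA := measurable_F sA.1.
exists (fine (P A)); first exact: fine_ge0.
rewrite (prob_black sA) (prob_red a0 a'0 sA) !EFinM fineK//.
exact: fin_num_measure.
Qed.

Let measurable_urn n (g : R -> R -> R) :
  measurable_fun setT (fun w => g (black_mass n w) (red_mass n w)).
Proof.
elim: n g => [|n IHn] g.
  rewrite /black_mass /red_mass /black /red.
  under eq_fun do rewrite !big_ord0; exact: measurable_cst.
have -> : (fun w => g (black_mass n.+1 w) (red_mass n.+1 w)) =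
    (fun w => if X n w then g (black_mass n w + 1) (red_mass n w)
              else g (black_mass n w) (red_mass n w + 1)).
  apply/funext => w; rewrite black_massS red_massS.
  by case: (X n w); rewrite /= ?addr0.
apply: measurable_fun_ifT => //.
- exact: (IHn (fun x y => g (x + 1) y)).
- exact: (IHn (fun x y => g x (y + 1))).
Qed.

Lemma urn_meanE g n m a a' A : (forall x y, 0 <= g x y) -> 0 < a -> 0 < a' ->
  at_state m a a' A ->
  (\int[P]_(w in A) (g (black_mass (m + n) w) (red_mass (m + n) w))%:E =
   P A * (urn_mean g n a a')%:E)%E.
Proof.
move=> g0; elim: n m a a' A => [|n IHn] m a a' A a0 a'0 sA.
  under eq_integral => w wA.
    rewrite addn0; have [|-> ->] := sA.2 w; first by rewrite inE in wA.
    over.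
  by rewrite integral_cst 1?muleC//; exact: measurable_F sA.1.
have sb := at_state_black sA; have sr := at_state_red sA.
have [u u0 [PA Pb Pr]] := at_state_P a0 a'0 sA.
rewrite {1}(draw_cases A m) ge0_integral_setU//=.
- rewrite -addSnnS (IHn _ (a + 1) a')// ?addr_gt0//.
  rewrite (IHn _ a (a' + 1))// ?addr_gt0// Pb Pr PA -!EFinM -EFinD.
  by rewrite mulrDr !mulrA.
- exact: measurable_F sb.1.
- exact: measurable_F sr.1.
- apply: measurable_funTS; apply/measurable_EFinP; exact: measurable_urn.
- by move=> w _; rewrite lee_fin.
Qed.

Let measurable_Z n : measurable_fun setT (Z n).
Proof.
have -> : Z n = (fun w => black_mass n w / (black_mass n w + red_mass n w)).
  by apply/funext => w; rewrite black_ratioE.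
exact: (measurable_urn n (fun x y => x / (x + y))).
Qed.

Definition excursion z e m n : set T :=
  [set w | exists2 j, (j <= n)%N & e < `|Z (m + j) w - z|].

Let measurable_excursion z e m n : measurable (excursion z e m n).
Proof.
have -> : excursion z e m n = \bigcup_(j in [set j | (j <= n)%N])
    (setT `&` (fun w => `|Z (m + j) w - z|) @^-1` `]e, +oo[%classic).
  apply/seteqP; split => [w [j jn ej]|w [j jn [_]]].
    by exists j => //; split => //=; rewrite in_itv/= ej.
  by rewrite /= in_itv/= andbT => ej; exists j.
apply: bigcup_measurable => j _.
have mf : measurable_fun setT (fun w => `|Z (m + j) w - z|).
  by apply: measurableT_comp => //; apply: measurable_funB => //; exact: measurable_Z.
by apply: mf => //; exact: measurable_itv.
Qed.

Let excursion_bound (z a a' : R) n : R :=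
  (a / (a + a') - z) ^+ 2 + ((a + a')^-1 - (a + a' + n%:R)^-1).

Let excursion_bound_ge0 z a a' n : 0 < a -> 0 < a' ->
  (a / (a + a') - z) ^+ 2 <= excursion_bound z a a' n.
Proof.
move=> a0 a'0; rewrite /excursion_bound lerDl subr_ge0.
have s0 : 0 < a + a' by rewrite addr_gt0.
by rewrite lef_pV2 ?posrE ?lerDl// ltr_wpDr.
Qed.

Let excursion_bound_step z a a' n : 0 < a -> 0 < a' ->
  a / (a + a') * excursion_bound z (a + 1) a' n +
  a' / (a + a') * excursion_bound z a (a' + 1) n <= excursion_bound z a a' n.+1.
Proof.
move=> a0 a'0; have s0 : 0 < a + a' by rewrite addr_gt0.
set s := a + a' in s0 *; set p := a / s; set q := (s + 1)^-1.
have p0 : 0 <= p by rewrite divr_ge0 ?ltW.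
have pE : a' / s = 1 - p by rewrite /p /s; field; rewrite gt_eqF.
have p1 : 0 <= 1 - p by rewrite -pE divr_ge0 ?ltW.
have s1 : 0 < s + 1 by rewrite addr_gt0.
have e1 : a + 1 + a' = s + 1 by rewrite /s; ring.
have e2 : a + (a' + 1) = s + 1 by rewrite /s; ring.
have e3 : s + 1 + n%:R = s + n.+1%:R by rewrite -natr1; ring.
rewrite pE /excursion_bound e1 e2 -/s -/p e3 -/q.
have -> : (a + 1) * q = p + (1 - p) * q.
  by rewrite /p /q; field; rewrite !gt_eqF.
have -> : a * q = p - p * q by rewrite /p /q; field; rewrite !gt_eqF.
set t := (s + n.+1%:R)^-1.
have q0 : 0 < q by rewrite invr_gt0.
have qs : q <= s^-1 by rewrite lef_pV2 ?posrE// lerDl.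
have sq : s^-1 - q = s^-1 * q by rewrite /q; field; rewrite !gt_eqF.
have : p * (1 - p) * q ^+ 2 <= s^-1 - q.
  rewrite sq; apply: (@le_trans _ _ (q ^+ 2)).
    by rewrite ler_piMl ?sqr_ge0//; nra.
  by rewrite expr2 ler_pM2r.
have -> : p * ((p + (1 - p) * q - z) ^+ 2 + (q - t)) +
  (1 - p) * ((p - p * q - z) ^+ 2 + (q - t)) =
  (p - z) ^+ 2 + p * (1 - p) * q ^+ 2 + (q - t) by ring.
by lra.
Qed.

Let excursion_big z e n m a a' A : 0 < e -> 0 < a -> 0 < a' ->
  at_state m a a' A -> e < `|a / (a + a') - z| ->
  (P (A `&` excursion z e m n) <=
   P A * (excursion_bound z a a' n / e ^+ 2)%:E)%E.
Proof.
move=> e0 a0 a'0 sA big; have mA := measurable_F sA.1.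
apply: (@le_trans _ _ (P A)).
  by apply: le_measure; rewrite ?inE//; exact: measurableI.
have [u u0 [-> _ _]] := at_state_P a0 a'0 sA.
rewrite -EFinM lee_fin ler_peMr// ler_pdivlMr ?exprn_gt0// mul1r.
apply: le_trans (excursion_bound_ge0 z n a0 a'0).
by rewrite -[leRHS]real_normK ?num_real// ler_pXn2r ?nnegrE// ltW.
Qed.

(** Kolmogorov's maximal inequality for the proportion of black balls. With
   [s = a + a'], a draw increases the mean squared distance to [z] by at most
   [1 / s - 1 / (s + 1)], and these increments telescope. *)
Lemma maximal_ineq z e n m a a' A : 0 < e -> 0 < a -> 0 < a' ->
  at_state m a a' A ->
  (P (A `&` excursion z e m n) <=
   P A * (((a / (a + a') - z) ^+ 2 + ((a + a')^-1 - (a + a' + n%:R)^-1)) / e ^+ 2)%:E)%E.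
Proof.
move=> e0; elim: n m a a' A => [|n IHn] m a a' A a0 a'0 sA;
  rewrite -/(excursion_bound z a a' _);
  (have [big|small] := ltP e `|a / (a + a') - z|;
    first exact: (excursion_big _ e0 a0 a'0 sA big));
  have ZA w (Aw : A w) : Z m w = a / (a + a') by
    rewrite black_ratioE; have [-> ->] := sA.2 w Aw.
  rewrite (_ : A `&` _ = set0) ?measure0.
    rewrite mule_ge0// lee_fin divr_ge0 ?exprn_ge0 ?(ltW e0)//.
    by apply: le_trans (excursion_bound_ge0 z 0 a0 a'0); exact: sqr_ge0.
  apply/seteqP; split => // w [Aw [j]]; rewrite leqn0 => /eqP ->.
  by rewrite addn0 ZA// ltNge small.
have [u u0 [PA Pb Pr]] := at_state_P a0 a'0 sA.
have mA := measurable_F sA.1.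
have sb := at_state_black sA; have sr := at_state_red sA.
have mb := measurable_F sb.1; have mr := measurable_F sr.1.
have mE := measurable_excursion z e m.+1 n.
apply: (@le_trans _ _ (P ((A `&` [set w | X m w = true]) `&` excursion z e m.+1 n) +
  P ((A `&` [set w | X m w = false]) `&` excursion z e m.+1 n))%E).
  have mb' := measurableI _ _ mb mE; have mr' := measurableI _ _ mr mE.
  apply: le_trans (measureU2 P mb' mr').
  apply: le_measure; rewrite ?inE.
  - exact: measurableI.
  - exact: measurableU.
  rewrite -setIUl -draw_cases => w [Aw [[|j] jn]].
    by rewrite addn0 ZA// ltNge small.
  by rewrite addnS -addSn => ej; split => //; exists j.
apply: le_trans (leeD (IHn _ (a + 1) a' _ _ _ sb) (IHn _ a (a' + 1) _ _ _ sr)) _;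
  rewrite ?addr_gt0//.
rewrite PA Pb Pr -!EFinM -EFinD lee_fin -!mulrA -mulrDr; apply: ler_wpM2l => //.
rewrite !mulrA -mulrDl; apply: ler_wpM2r; first by rewrite invr_ge0 exprn_ge0// ltW.
exact: excursion_bound_step.
Qed.

Let oscillation e m n : set T :=
  [set w | exists2 j, (j <= n)%N & e < `|Z (m + j) w - Z m w|].

Let measurable_oscillation e m n : measurable (oscillation e m n).
Proof.
have -> : oscillation e m n = \bigcup_(j in [set j | (j <= n)%N])
    (setT `&` (fun w => `|Z (m + j) w - Z m w|) @^-1` `]e, +oo[%classic).
  apply/seteqP; split => [w [j jn ej]|w [j jn [_]]].
    by exists j => //; split => //=; rewrite in_itv/= ej.
  by rewrite /= in_itv/= andbT => ej; exists j.
apply: bigcup_measurable => j _.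
have mf : measurable_fun setT (fun w => `|Z (m + j) w - Z m w|).
  by apply: measurableT_comp => //; apply: measurable_funB; exact: measurable_Z.
by apply: mf => //; exact: measurable_itv.
Qed.

(** The maximal inequality with the random centre [Z (m + k)]: the induction on [k]
   reaches the events on which this centre is known. *)
Let oscillation_le e n m k a a' A : 0 < e -> 0 < a -> 0 < a' ->
  at_state m a a' A ->
  (P (A `&` oscillation e (m + k) n) <=
   P A * ((a + a' + k%:R)^-1 / e ^+ 2)%:E)%E.
Proof.
move=> e0; elim: k m a a' A => [|k IHk] m a a' A a0 a'0 sA.
  have -> : A `&` oscillation e (m + 0) n = A `&` excursion (a / (a + a')) e m n.
    apply/seteqP; split => w [Aw [j jn ej]]; split => //; exists j => //;
      move: ej; rewrite addn0; congr (_ < `|_ - _|);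
      by rewrite black_ratioE; have [-> ->] := sA.2 w Aw.
  apply: le_trans (maximal_ineq _ _ e0 a0 a'0 sA) _.
  apply: lee_wpmul2l => //; rewrite lee_fin subrr expr0n add0r addr0.
  rewrite ler_wpM2r// ?invr_ge0 ?exprn_ge0 ?(ltW e0)//.
  by rewrite gerBl invr_ge0 addr_ge0// ltW// addr_gt0.
have [u u0 [PA Pb Pr]] := at_state_P a0 a'0 sA.
have sb := at_state_black sA; have sr := at_state_red sA.
have mb := measurable_F sb.1; have mr := measurable_F sr.1.
have mE := measurable_oscillation e (m + k.+1) n.
apply: (@le_trans _ _ (P ((A `&` [set w | X m w = true]) `&` oscillation e (m + k.+1) n) +
  P ((A `&` [set w | X m w = false]) `&` oscillation e (m + k.+1) n))%E).
  have mb' := measurableI _ _ mb mE; have mr' := measurableI _ _ mr mE.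
  apply: le_trans (measureU2 P mb' mr').
  by rewrite -setIUl -draw_cases.
rewrite -addSnnS.
apply: le_trans (leeD (IHk _ (a + 1) a' _ _ _ sb) (IHk _ a (a' + 1) _ _ _ sr)) _;
  rewrite ?addr_gt0//.
rewrite PA Pb Pr -!EFinM -EFinD lee_fin.
have e1 : a + 1 + a' + k%:R = a + a' + k.+1%:R by rewrite -natr1; ring.
have e2 : a + (a' + 1) + k%:R = a + a' + k.+1%:R by rewrite -natr1; ring.
rewrite e1 e2 -mulrDl -mulrDr -mulrDl divff ?mulr1//.
by rewrite gt_eqF// addr_gt0.
Qed.

Lemma at_state0 : at_state 0 (b%:R / c%:R) (r%:R / c%:R) setT.
Proof.
split; first exact: (@measurableT _ (g_sigma_algebraType (first_draws X 0))).
move=> w _; rewrite /black_mass /red_mass /black /red !big_ord0.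
by rewrite !muln0 !addn0.
Qed.

(** Letting the horizon of the maximal inequality tend to infinity bounds the
   probability of an oscillation by [e] after time [m] by a multiple of
   [1 / (m + 1)]; so almost surely there is no oscillation after some time. *)
Lemma black_ratio_cauchy :
  {ae P, forall w, forall e, 0 < e ->
    exists m, forall j, `|Z (m + j) w - Z m w| <= e}.
Proof.
pose osc e m := \bigcup_n oscillation e m n.
have mosc e m : measurable (osc e m).
  by apply: bigcup_measurable => n _; exact: measurable_oscillation.
have a0 : 0 < b%:R / c%:R :> R by rewrite divr_gt0 ?ltr0n.
have a'0 : 0 < r%:R / c%:R :> R by rewrite divr_gt0 ?ltr0n.
have Posc e m : 0 < e -> (P (osc e m) <= (m.+1%:R^-1 * ((c%:R + 1) / e ^+ 2))%:E)%E.
  move=> e0.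
  have cvg : P (oscillation e m n) @[n --> \oo] --> P (osc e m).
    apply: nondecreasing_cvg_mu => //; first exact: mosc.
    move=> n1 n2 n12; apply/subsetPset => w [j jn ej]; exists j => //.
    exact: leq_trans jn n12.
  apply: (cvge_le _ cvg); apply: nearW => n.
  have := oscillation_le n m e0 a0 a'0 at_state0.
  rewrite setTI add0n probability_setT mul1e => /le_trans; apply.
  rewrite lee_fin mulrA ler_wpM2r// ?invr_ge0 ?exprn_ge0 ?(ltW e0)//.
  have q0 : 0 < b%:R / c%:R + r%:R / c%:R + m%:R :> R by rewrite ltr_wpDr ?addr_gt0.
  rewrite [leRHS]mulrC ler_pdivlMr ?ltr0n// [leLHS]mulrC ler_pdivrMr//.
  rewrite mulrDl mul1r mulrDr mulrDr mulrCA divff// mulr1 mulrCA divff// mulr1 -natr1.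
  have h1 : 1 <= b%:R :> R by rewrite ler1n.
  have h2 : 0 <= c%:R * m%:R :> R by rewrite mulr_ge0.
  have h3 : 0 <= r%:R :> R by [].
  lra.
have null e : 0 < e -> P.-negligible (\bigcap_m osc e m).
  move=> e0; apply/negligibleP; first by apply: bigcap_measurableType => m _.
  apply/eqP; rewrite eq_le measure_ge0 andbT.
  have cv : (m.+1%:R^-1 * ((c%:R + 1) / e ^+ 2))%:E @[m --> \oo] --> (0 : R)%:E.
    apply: cvg_EFin; first exact: nearW.
    rewrite -[X in _ --> X](mul0r ((c%:R + 1) / e ^+ 2)).
    by apply: cvgMl; exact: cvg_harmonic.
  apply: (cvge_ge _ cv); apply: nearW => m; apply: le_trans (Posc e m e0).
  apply: le_measure; rewrite ?inE//.
    exact: bigcap_measurableType.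
  exact: bigcap_inf.
have : P.-negligible (\bigcup_l \bigcap_m osc l.+1%:R^-1 m).
  by apply: negligible_bigcup => l; apply: null; rewrite invr_gt0.
apply: negligibleS => w /= nw; apply: contrapT => cw; apply: nw => e e0.
have [l le] : exists l : nat, l.+1%:R^-1 <= e.
  have /cvgrPdist_le /(_ _ e0) [l _ Hl] := @cvg_harmonic R.
  exists l; have := Hl l (leqnn l).
  by rewrite sub0r normrN ger0_norm ?harmonic_ge0.
apply: contrapT => ne; apply: cw; exists l => // m _.
apply: contrapT => nosc; apply: ne; exists m => j.
rewrite leNgt; apply/negP => ej; apply: nosc; exists j => //; exists j => //.
exact: le_lt_trans ej.
Qed.

Lemma black_ratio_cvg : exists Zoo : {RV P >-> R},
  {ae P, forall w, Z n w @[n --> \oo] --> Zoo w}.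
Proof.
pose f w := fine (limn_esup (fun n => (Z n w)%:E)).
have mf : measurable_fun setT f.
  apply: (measurableT_comp (fine_measurable measurableT)).
  apply: measurable_fun_limn_esup => n; apply/measurable_EFinP; exact: measurable_Z.
pose Zoo : {RV P >-> R} := HB.pack f (isMeasurableFun.Build _ _ _ _ f mf).
exists Zoo; apply: filterS black_ratio_cauchy => w cw.
have cvw : cvgn (Z ^~ w).
  apply: cauchy_cvg; apply/cauchy_exP => e e0.
  have [m Hm] := cw (e / 2) (divr_gt0 e0 (ltr0n _ 2)).
  exists (Z m w); exists m => // n mn; rewrite /= /ball/=.
  rewrite distrC -(subnKC mn) (le_lt_trans (Hm _))//.
  by rewrite ltr_pdivrMr// ltr_pMr// ltr1n.
suff -> : Zoo w = limn (Z ^~ w) by [].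
rewrite /= /f.
have -> : limn_esup (fun n => (Z n w)%:E) = (limn (Z ^~ w))%:E.
  have cE : (Z n w)%:E @[n --> \oo] --> (limn (Z ^~ w))%:E.
    by apply: cvg_EFin; [exact: nearW|exact: cvw].
  rewrite is_cvg_limn_esupE; first exact/cvg_lim.
  by apply/cvg_ex; exists (limn (Z ^~ w))%:E.
by [].
Qed.

(** * The limit of the proportions and its conditional laws *)

Section limit_law.
Notation mu := (@lebesgue_measure R).
Variable Zoo : {RV P >-> R}.
Hypothesis Z_cvg : {ae P, forall w, Z n w @[n --> \oo] --> Zoo w}.

(** The integral of [f] of the proportion at time [m + n] is computed by
   [urn_meanE]; letting [n] tend to infinity gives the limit on the left side and
   [urn_mean_cvg] on the right side. *)
Let integral_limit (f : R -> R) L m a a' A : 0 <= L ->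
  (forall y z, `|f y - f z| <= L * `|y - z|) -> (forall y, 0 <= f y <= 1) ->
  0 < a -> 0 < a' -> at_state m a a' A ->
  (\int[P]_(w in A) (f (Zoo w))%:E =
   P A * \int[mu]_x (beta_density a a' x * f x)%:E)%E.
Proof.
move=> L0 fL f01 a0 a'0 sA; have mA := measurable_F sA.1.
have mf : measurable_fun setT f.
  by apply: continuous_measurable_fun; exact: lipschitz_continuous fL.
have cf : continuous f by exact: lipschitz_continuous fL.
have mfZ n : measurable_fun A (fun w => (f (Z n w))%:E).
  apply/measurable_EFinP/measurable_funTS; exact: measurableT_comp (measurable_Z n).
have mfZoo : measurable_fun A (fun w => (f (Zoo w))%:E).
  by apply/measurable_EFinP/measurable_funTS; exact: measurableT_comp.
have [||_ _ cvI] := @dominated_convergence _ _ _ P A mA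
  (fun n w => (f (Z (m + n) w))%:E) (fun w => (f (Zoo w))%:E) (cst 1%E)
  (fun n => mfZ (m + n)%N) mfZoo _ (finite_measure_integrable_cst P 1 mA).
- apply: filterS Z_cvg => w cw _; apply: cvg_EFin; first exact: nearW.
  have : Z (m + n) w @[n --> \oo] --> Zoo w.
    rewrite (_ : (fun n => Z (m + n) w) = (fun n => Z (n + m) w)).
      by rewrite (cvg_shiftn m (fun n => Z n w)).
    by apply/funext => n; rewrite addnC.
  by move/cvg_comp; apply; exact: cf.
- apply: aeW => w n _; rewrite /= lee_fin.
  by have /andP[h1 h2] := f01 (Z (m + n) w); rewrite ger0_norm.
apply: (cvg_unique _ cvI) => //.
have e n : (\int[P]_(w in A) (f (Z (m + n) w))%:E =
    P A * (urn_mean (fun y z => f (y / (y + z))) n a a')%:E)%E.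
  rewrite -(urn_meanE n _ a0 a'0 sA); last by move=> x y; have /andP[] := f01 (x / (x + y)).
  by apply: eq_integral => w _; rewrite black_ratioE.
rewrite (_ : [sequence _]_n = fun n => (P A * (urn_mean (fun y z => f (y / (y + z))) n a a')%:E)%E).
  by apply: cvgeZl; [exact: fin_num_measure|exact: (urn_mean_cvg L0)].
by apply/funext => n; exact: e.
Qed.

(** Lipschitz functions increasing to the indicator of the open ray below [t]. *)
Let ramp (t : R) (k : nat) (x : R) := Num.min 1 (Num.max 0 (k.+1%:R * (t - x))).

Let ramp01 t k x : 0 <= ramp t k x <= 1.
Proof. by rewrite /ramp le_min ler01 le_max lexx ge_min lexx. Qed.

Let ramp_lip t k x y : `|ramp t k x - ramp t k y| <= k.+1%:R * `|x - y|.
Proof.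
have -> : k.+1%:R * `|x - y| = `|k.+1%:R * (t - x) - k.+1%:R * (t - y)|.
  rewrite -mulrBr normrM (ger0_norm (ler0n _ _)); congr (_ * _).
  by rewrite distrC; congr `|_|; ring.
rewrite /ramp; move: (_ * (t - x)) (_ * (t - y)) => u v.
have h1 : `|Num.max 0 u - Num.max 0 v| <= `|u - v|.
  by have [?|?] := leP 0 u; have [?|?] := leP 0 v; rewrite ler_norml;
    have h2 := ler_norm (u - v); have h3 := ler_norm (v - u);
    rewrite distrC in h3; apply/andP; split; lra.
apply: le_trans h1; move: (Num.max 0 u) (Num.max 0 v) => {}u {}v.
by have [?|?] := leP 1 u; have [?|?] := leP 1 v; rewrite ler_norml;
    have h2 := ler_norm (u - v); have h3 := ler_norm (v - u);
    rewrite distrC in h3; apply/andP; split; lra.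
Qed.

Let ramp_cvg t x : ramp t k x @[k --> \oo] --> (\1_(`]-oo, t[) x : R).
Proof.
rewrite indicE; case: (boolP (x \in _)) => [|].
  rewrite inE /= in_itv/= => xt; have tx : 0 < t - x by rewrite subr_gt0.
  apply: (@cvg_trans _ ((fun=> 1%:R : R) k @[k --> \oo])); last exact: cvg_cst.
  have /cvgrPdist_le /(_ _ tx) [l _ Hl] := @cvg_harmonic R.
  apply: near_eq_cvg; exists l => // k /= lk; rewrite /ramp.
  have := Hl k lk; rewrite sub0r normrN ger0_norm ?harmonic_ge0// /harmonic/= => h.
  have h1 : 1 <= k.+1%:R * (t - x).
    by rewrite -ler_pdivrMl// mulr1.
  rewrite (max_idPr _) ?(le_trans ler01)//.
  by apply/esym/min_idPl.
rewrite notin_setE /= in_itv/= => /negP; rewrite -leNgt => tx.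
apply: (@cvg_trans _ ((fun=> 0%:R : R) k @[k --> \oo])); last exact: cvg_cst.
apply: near_eq_cvg; near=> k; rewrite /ramp (max_idPl _).
  by apply/esym/min_idPr; exact: ler01.
by rewrite mulr_ge0_le0// subr_le0.
Unshelve. all: by end_near. Qed.

(** The masses in the urn at time [m] are the parameters of the conditional law of
   the limit. The two measures agree on open rays, by approximation of their
   indicators, and hence on Borel sets. *)
Lemma limit_law m a a' A (V : set R) : 0 < a -> 0 < a' -> at_state m a a' A ->
  measurable V -> P (A `&` Zoo @^-1` V) = (P A * beta_law a a' V)%E.
Proof.
move=> a0 a'0 sA mV; have mA := measurable_F sA.1.
have PA_ge0 : 0 <= fine (P A) by exact: fine_ge0.
have PAE : P A = (fine (P A))%:E by rewrite fineK// fin_num_measure.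
have mZoo' : measurable_fun setT Zoo by exact: measurable_funP.
have mZoo : measurable_fun setT (Zoo : T -> measurableTypeR R) by exact: mZoo'.
pose m1 := measure_function_pushforward__canonical__measure_function_Measure
  (mrestr P mA) mZoo.
pose m2 : {measure set (measurableTypeR R) -> \bar R} := mscale (NngNum PA_ge0) (beta_law a a').
have m1E U : m1 U = P (A `&` Zoo @^-1` U) by rewrite setIC.
have m2E U : m2 U = (P A * beta_law a a' U)%E by rewrite PAE.
rewrite -m1E -m2E.
apply: (@measure_unique _ R (measurableTypeR R) (@RGenInftyO.G R)
  (fun n => `]-oo, n%:R[%classic) _ _ _ _ m1 m2) => //.
- exact: RGenInftyO.measurableE.
- move=> _ _ [x ->] [y ->]; exists (Num.min x y).
  apply/seteqP; split => z /=; rewrite !in_itv/= lt_min; first by case=> -> ->.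
  by move=> /andP[].
- by move=> n; exists n%:R.
- apply/seteqP; split => // x _; exists (Num.truncn x).+1 => //=.
  by rewrite in_itv/= truncnS_gt.
- move=> _ [t ->]; rewrite m1E m2E.
  have mray : measurable (`]-oo, t[%classic : set R) by exact: measurable_itv.
  have mramp k : measurable_fun setT (ramp t k).
    by apply: continuous_measurable_fun; exact: lipschitz_continuous (@ramp_lip t k).
  have mind (D : set R) : measurable D -> measurable_fun setT (\1_D : R -> R).
    by move=> mD; exact: measurable_indic.
  have -> : P (A `&` Zoo @^-1` `]-oo, t[%classic) =
      (\int[P]_(w in A) (\1_(`]-oo, t[) (Zoo w))%:E)%E.
    rewrite (eq_integral (fun w => (\1_(Zoo @^-1` `]-oo, t[%classic) w)%:E))//.
    rewrite integral_indic// 1?setIC//.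
    by rewrite -[X in measurable X]setTI; exact: mZoo'.
  have -> : beta_law a a' `]-oo, t[%classic =
      (\int[mu]_x (beta_density a a' x * \1_(`]-oo, t[) x)%:E)%E.
    rewrite beta_lawE integral_mkcond; apply: eq_integral => x _.
    by rewrite patchE indicE; case: (x \in _); rewrite ?mulr1 ?mulr0.
  have ramp_norm k x : `|ramp t k x| <= 1.
    by have /andP[h1 h2] := ramp01 t k x; rewrite ger0_norm.
  have mfr k : measurable_fun A (fun w => (ramp t k (Zoo w))%:E).
    by apply/measurable_EFinP/measurable_funTS; exact: measurableT_comp (mramp k) mZoo'.
  have mfi : measurable_fun A (fun w => (\1_(`]-oo, t[) (Zoo w) : R)%:E).
    apply/measurable_EFinP/measurable_funTS.
    by apply: (measurableT_comp (mind _ _) mZoo'); exact: measurable_itv.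
  have [||_ _ c1] := @dominated_convergence _ _ _ P A mA
    (fun k w => (ramp t k (Zoo w))%:E) (fun w => (\1_(`]-oo, t[) (Zoo w))%:E)
    (cst 1%E) mfr mfi _ (finite_measure_integrable_cst P 1 mA).
  + by apply: aeW => w _; apply: cvg_EFin; [exact: nearW|exact: ramp_cvg].
  + by apply: aeW => w k _; rewrite /= lee_fin.
  have mdr k : measurable_fun setT (fun x => (beta_density a a' x * ramp t k x)%:E).
    apply/measurable_EFinP; apply: measurable_funM; last exact: mramp.
    exact: measurable_beta_density.
  have mdi : measurable_fun setT (fun x => (beta_density a a' x * \1_(`]-oo, t[) x)%:E).
    apply/measurable_EFinP; apply: measurable_funM; last exact: mind.
    exact: measurable_beta_density.
  have [||_ _ c2] := @dominated_convergence _ _ _ mu setT measurableT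
    (fun k x => (beta_density a a' x * ramp t k x)%:E)
    (fun x => (beta_density a a' x * \1_(`]-oo, t[) x)%:E)
    (EFin \o beta_density a a') mdr mdi _ (integrable_beta_density a0 a'0).
  + apply: aeW => x _; apply: cvg_EFin; first exact: nearW.
    by apply: cvgMr; exact: ramp_cvg.
  + apply: aeW => x k _; rewrite /= lee_fin normrM ger0_norm ?beta_density_ge0//.
    by rewrite ler_piMr// beta_density_ge0.
  apply: (cvg_unique _ c1) => //.
  rewrite (_ : [sequence _]_k =
      fun k => (P A * \int[mu]_x (beta_density a a' x * ramp t k x)%:E)%E).
    by apply: cvgeZl; [exact: fin_num_measure|exact: c2].
  apply/funext => k.
  by rewrite /= (integral_limit (ler0n _ _) (ramp_lip t k) (ramp01 t k) a0 a'0 sA).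
- move=> n; rewrite m1E; apply: (@le_lt_trans _ _ 1%E); last exact: ltry.
  apply: probability_le1; apply: measurableI => //.
  by rewrite -[X in measurable X]setTI; apply: mZoo' => //; exact: measurable_itv.
Qed.

(** The Beta law charges neither 0 nor 1, so the limit variance is positive. *)
Lemma limit_itv : {ae P, forall w, 0 < Zoo w < 1}.
Proof.
have a0 : 0 < b%:R / c%:R :> R by rewrite divr_gt0 ?ltr0n.
have a'0 : 0 < r%:R / c%:R :> R by rewrite divr_gt0 ?ltr0n.
have mitv : measurable (~` `]0, 1[%classic : set R) by exact: measurableC.
exists (Zoo @^-1` (~` `]0, 1[%classic)); split.
- by rewrite -[X in measurable X]setTI; exact: measurable_funP.
- have := limit_law a0 a'0 at_state0 mitv; rewrite setTI => ->.
  rewrite /beta_law setICl integral_set0 mule0//.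
- by move=> w /= nw; rewrite in_itv.
Qed.

Let atom n w : set T := [set v | forall i, (i < n)%N -> X i v = X i w].

Let atomS n w : atom n.+1 w = atom n w `&` [set v | X n v = X n w].
Proof.
apply/seteqP; split => [v vw|v [vw vn] i].
  by split => [i ni|]; apply: vw => //; exact: ltnW.
by rewrite ltnS leq_eqVlt => /predU1P[->//|]; exact: vw.
Qed.

Let at_state_atom n w : at_state n (black_mass n w) (red_mass n w) (atom n w).
Proof.
split.
  elim: n => [|n IHn].
    rewrite (_ : atom 0 w = setT); last by apply/seteqP.
    exact: (@measurableT _ (g_sigma_algebraType (first_draws X 0))).
  by rewrite atomS; apply: F_I; [exact: first_drawsS IHn|exact: draw_in].
move=> v vw; rewrite /black_mass /red_mass /black /red.
by split; congr ((_ + _ * _)%:R / _); apply: eq_bigr => i _; rewrite vw.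
Qed.

Let atom_gt0 n w : (0 < P (atom n w))%E.
Proof.
elim: n => [|n IHn].
  by rewrite (_ : atom 0 w = setT) ?probability_setT//; apply/seteqP.
have sA := at_state_atom n w.
have a0 := black_mass_gt0 n w; have a'0 := red_mass_gt0 n w.
have s0 : 0 < black_mass n w + red_mass n w by rewrite addr_gt0.
rewrite atomS; case: (X n w).
  by rewrite (prob_black sA) mule_gt0// lte_fin divr_gt0.
by rewrite (prob_red a0 a'0 sA) mule_gt0// lte_fin divr_gt0.
Qed.

Let atom_sub n w (B : set T) : F n B -> forall v, atom n w v -> B v <-> B w.
Proof.
suff : F n `<=` [set B | forall v, atom n w v -> B v <-> B w] by exact.
apply: smallest_sub.
  split => //= [D ID v vw|D ID v vw].
    by have := ID v vw; rewrite /setD/=; tauto.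
  by split=> -[k _ Dk]; exists k => //; apply/(ID k v vw).
move=> _ [i /= ni [Y mY <-]] v vw.
by rewrite /= /preimage/= vw.
Qed.

(** A kernel measurable for the first [n] draws is constant on each atom, and
   every atom has positive probability. So any two versions of the conditional
   law agree at every point, and their value is given by [limit_law]. *)
Let cond_distributionE
    (k : forall n, R.-pker (g_sigma_algebraType (first_draws X n)) ~> (measurableTypeR R)) :
  (forall n, regular_cond_distribution P
     (fun w => Num.sqrt n%:R * (Zoo w - Z n w)) (k n)) ->
  forall n w (U : set R), measurable U ->
    k n w U = beta_law (black_mass n w) (red_mass n w)
      [set x | U (Num.sqrt n%:R * (x - Z n w))].
Proof.
move=> kP n w U mU.
have sA := at_state_atom n w; have mA := measurable_F sA.1.
have a0 := black_mass_gt0 n w; have a'0 := red_mass_gt0 n w.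
have kc v : atom n w v -> k n v U = k n w U.
  have Fk : F n [set v | k n v U = k n w U].
    have := measurable_kernel (k n) U mU measurableT _ (emeasurable_set1 (k n w U)).
    by rewrite setTI.
  by move=> /(atom_sub Fk) /= ->.
have := kP n (atom n w) U sA.1 mU.
rewrite (eq_integral (cst (k n w U))); last first.
  by move=> v; rewrite inE => /kc.
rewrite integral_cst//.
have -> : atom n w `&` (fun w => Num.sqrt n%:R * (Zoo w - Z n w)) @^-1` U =
    atom n w `&` Zoo @^-1` [set x | U (Num.sqrt n%:R * (x - Z n w))].
  have ZA v : atom n w v -> Z n v = Z n w.
    by move=> vw; rewrite !black_ratioE; have [-> ->] := sA.2 v vw.
  by apply/seteqP; split => v [vw /=]; rewrite ZA.
rewrite (limit_law a0 a'0 sA); last first.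
  have mphi : measurable_fun setT (fun x : R => Num.sqrt n%:R * (x - Z n w)).
    by apply: measurable_funM => //; exact: measurable_funB.
  by rewrite -[X in measurable X]setTI; exact: mphi.
rewrite muleC => h; apply/eqP; rewrite eq_le.
have Pf : P (atom n w) \is a fin_num by exact: fin_num_measure.
by apply/andP; split; rewrite -(lee_pmul2l Pf (atom_gt0 n w)) h.
Qed.

(** By [cond_distributionE] the convergence is a statement about Beta laws for
   each fixed outcome, with mean [Z n w] converging to [Zoo w]. *)
Lemma cond_distribution_cvg
    (k : forall n, R.-pker (g_sigma_algebraType (first_draws X n)) ~> (measurableTypeR R)) :
  (forall n, regular_cond_distribution P
     (fun w => Num.sqrt n%:R * (Zoo w - Z n w)) (k n)) ->
  as_weak_cvg P (fun n w => k n w) (fun w => centered_normal (Zoo w * (1 - Zoo w))).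
Proof.
move=> /cond_distributionE kE.
have : {ae P, forall w, 0 < Zoo w < 1 /\ Z n w @[n --> \oo] --> Zoo w}.
  by apply: filterS2 limit_itv Z_cvg.
apply: filterS => w [z01 cw].
have Z01 n : 0 < Z n w < 1.
  have a0 := black_mass_gt0 n w; have a'0 := red_mass_gt0 n w.
  have s0 : 0 < black_mass n w + red_mass n w by rewrite addr_gt0.
  by rewrite black_ratioE divr_gt0// ltr_pdivrMr// mul1r ltrDl.
apply: (beta_local_limit mass_gt0 z01 Z01 cw) => n U mU.
have s0 : 0 < black_mass n w + red_mass n w.
  by rewrite addr_gt0.
apply: etrans (kE n w U mU) _.
have E1 : ((b + r)%:R / c%:R + n%:R) * Z n w = black_mass n w.
  by rewrite -(total_mass n w) black_ratioE mulrC divfK// gt_eqF.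
have E2 : ((b + r)%:R / c%:R + n%:R) * (1 - Z n w) = red_mass n w.
  by rewrite mulrBr E1 mulr1 -(total_mass n w) addrC addKr.
by rewrite E1 E2.
Qed.

End limit_law.

End urn_process.

Theorem mainTheorem5 (R : realType) (d : measure_display) (T : measurableType d)
    (P : probability T R) (b r c : nat) (X : nat -> {RV P >-> bool})
    (hb : (1 <= b)%N) (hr : (1 <= r)%N) (hc : (1 <= c)%N)
    (urn : polya_urn b r c X) :
  (exists Zoo : {RV P >-> R},
     {ae P, forall w, black_ratio b r c X n w @[n --> \oo] --> Zoo w}) /\
  (forall Zoo : {RV P >-> R},
     {ae P, forall w, black_ratio b r c X n w @[n --> \oo] --> Zoo w} ->
     (forall U : set R, measurable U ->
        distribution P Zoo U = beta_law (b%:R / c%:R) (r%:R / c%:R) U) /\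
     (forall k : (forall n : nat,
          R.-pker (g_sigma_algebraType (first_draws X n)) ~> (measurableTypeR R)),
        (forall n : nat, regular_cond_distribution P
           (fun w => Num.sqrt n%:R * (Zoo w - black_ratio b r c X n w)) (k n)) ->
        as_weak_cvg P (fun n w => k n w)
          (fun w => centered_normal (Zoo w * (1 - Zoo w))))).

Proof.
split; first exact: black_ratio_cvg hb hr hc urn.
move=> Zoo Z_cvg; split.
  move=> U mU.
  have a0 : 0 < b%:R / c%:R :> R by rewrite divr_gt0 ?ltr0n.
  have a'0 : 0 < r%:R / c%:R :> R by rewrite divr_gt0 ?ltr0n.
  have := limit_law hc urn Z_cvg a0 a'0 (at_state0 _ _ _ _) mU.
  by rewrite setTI probability_setT mul1e.
move=> k kP; exact: (cond_distribution_cvg hb hr hc urn Z_cvg kP).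
Qed.
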